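(* There are universal constants $M>0$ and $\varepsilon>0$ such that the following holds. Let $X$ be any infinite-dimensional real Banach space with closed unit ball $B_X$, let $z\in X$ and $z^*\in X^*$ satisfy $z^*(z)=\|z^*\|=\|z\|=1$, let $H=\ker z^*$ (so $X=H\oplus[z]$), and let $C=\{x+tz: x\in H,\ \|x\|<\varepsilon,\ t>0\}$. Then there exists an injective map $\pi:C\to B_X$ which is a $C^\infty$ diffeomorphism onto its image $T=\pi(C)$, $T$ is a bounded open subset of $X$, and the derivatives of $\pi:C\to T$ and of $\pi^{-1}:T\to C$ are both bounded in norm by $M$ at every point.
   Context: $[z]$ denotes the linear span of $z$. Derivatives are Fréchet derivatives; the norm of a derivative is the operator norm. *)

(* Defs.v *)
From HB Require Import structures.
From mathcomp Require Import all_boot all_order all_algebra.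
From mathcomp Require Import all_classical all_reals all_analysis.
Set Implicit Arguments. Unset Strict Implicit. Unset Printing Implicit Defensive.
Import Order.TTheory GRing.Theory Num.Theory.
Import numFieldNormedType.Exports.
Local Open Scope classical_set_scope.
Local Open Scope ring_scope.

Section Defs.
Context {R : realType}.

Definition opnorm {V W : normedModType R} (f : V -> W) : \bar R :=
  ereal_sup [set (`|f x|)%:E | x in [set x : V | `|x| <= 1]].

Definition infinite_dimensional (X : normedModType R) : Prop :=
  ~ exists (n : nat) (e : 'I_n -> X),
      forall x : X, exists c : 'I_n -> R, x = \sum_(i < n) c i *: e i.

Definition upd {V : Type} {n : nat} (v : 'I_n -> V) (i : 'I_n) (u : V) : 'I_n -> V :=
  fun j => if j == i then u else v j.

Definition multilinear {V W : lmodType R} {n : nat} (A : ('I_n -> V) -> W) : Prop :=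
  forall (v : 'I_n -> V) (i : 'I_n) (a : R) (u w : V),
    A (upd v i (a *: u + w)) = a *: A (upd v i u) + A (upd v i w).

Definition mnorm {V W : normedModType R} {n : nat} (A : ('I_n -> V) -> W) : \bar R :=
  ereal_sup [set (`|A v|)%:E | v in [set v : 'I_n -> V | forall i, `|v i| <= 1]].

Definition vcons {V : Type} {n : nat} (h : V) (v : 'I_n -> V) : 'I_n.+1 -> V :=
  fun j => if unlift ord0 j is Some j' then v j' else h.

(* f is C^oo (Frechet) on U: there are maps D n x, bounded n-linear,
   with D 0 x = f x, and D n.+1 x the Frechet derivative of D n at x
   (identifying L(X, L^n(X,Y)) with L^(n+1)(X,Y)). *)
Definition smooth_on {V W : normedModType R} (U : set V) (f : V -> W) : Prop :=
  exists D : forall n : nat, V -> ('I_n -> V) -> W,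
    (forall x v, U x -> D 0%N x v = f x) /\
    (forall n x, U x -> multilinear (D n x) /\ (mnorm (D n x) < +oo)%E) /\
    (forall n x, U x -> forall e : R, 0 < e -> exists2 d : R, 0 < d &
        forall h : V, `|h| < d -> U (x + h) ->
          (mnorm (fun v => (D n (x + h) v - D n x v - D n.+1 x (vcons h v))%R)
            <= (e * `|h|)%:E)%E).

End Defs.

(* Main.v *)
(**
   Split [X = H + [z]] and let [gamma] be a smooth Lipschitz curve in [H] that
   goes from [e k] to [e k + e k.+1] and then to [e k.+1] for each [k], where [e] is a
   bounded sequence.  Let [g] be a smooth function on a neighbourhood of [gamma] in [H]
   with bounded gradient and [g (gamma t)] at bounded distance of [t].  Then the
   composition of the shear [(x, t) |-> (x + gamma t, t)] and of the shear
   [(y, t) |-> (y, t - g y)] maps the tube onto a bounded set, is inverted by the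
   opposite shears, and both maps have derivatives bounded independently of [X].
   Such an unbounded [g] exists because, in infinite dimension, Riesz' lemma and
   Hahn-Banach give [e k] with [|e k| <= 4] and functionals [f k] of norm at most one
   with [f k (e k) = 1] that vanish at [z] and at all the previous [e i]: on the [k]-th
   stretch one takes [g = k + ramp (f k.+1)].
   On the [k]-th piece of the tube both shears are built from finitely many vectors,
   linear functionals and the flat functions [x ^- n * exp (- 1 / x)]; terms in these
   are closed under differentiation, which gives the derivatives of all orders.
*)
Require Import Defs.
From HB Require Import structures.
From mathcomp Require Import all_boot all_order all_algebra.
From mathcomp Require Import all_classical all_reals all_analysis.
From mathcomp Require Import ring lra.
Import Order.TTheory GRing.Theory Num.Theory.
Import numFieldNormedType.Exports.
Local Open Scope classical_set_scope.
Local Open Scope ring_scope.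
Set Implicit Arguments.
Unset Strict Implicit.
Unset Printing Implicit Defensive.

(** * Hahn-Banach for sublinear functionals *)

Section SublinearFunctionals.
Context {R : realType} {X : lmodType R}.

Definition sublinear (q : X -> R) : Prop :=
  (forall x y, q (x + y) <= q x + q y) /\
  (forall a x, 0 <= a -> q (a *: x) = a * q x).

Lemma sublinear0 q : sublinear q -> q 0 = 0.
Proof. by case=> _ h; rewrite -(scale0r 0) h // mul0r. Qed.

Lemma sublinear_ge_opp q x : sublinear q -> - q (- x) <= q x.
Proof.
move=> qs; have := qs.1 x (- x).
by rewrite subrr (sublinear0 qs) -lerBlDr sub0r.
Qed.

(** The hypothesis for [a^-1] at the point [a *: x] is the converse inequality for [a] at [x]. *)
Lemma sublinear_scale_le (q : X -> R) : q 0 = 0 ->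
  (forall a x, 0 < a -> q (a *: x) <= a * q x) ->
  forall a x, 0 <= a -> q (a *: x) = a * q x.
Proof.
move=> q0 hq a x; rewrite le_eqVlt => /orP[/eqP<-|a0].
  by rewrite scale0r mul0r.
apply/eqP; rewrite eq_le hq //=.
have := hq a^-1 (a *: x); rewrite invr_gt0 => /(_ a0).
by rewrite scalerA mulVf ?gt_eqF// scale1r ler_pdivlMl.
Qed.

(* The largest sublinear functional below [q] whose value at [- y] is [- q y] *)
Definition shave (q : X -> R) (y : X) : X -> R :=
  fun x => inf [set r | exists2 t : R, 0 <= t & r = q (x + t *: y) - t * q y].

Section Shave.
Variables (q : X -> R) (y : X).
Hypothesis qs : sublinear q.

Let has_lb x : lbound [set r | exists2 t : R, 0 <= t & r = q (x + t *: y) - t * q y] (- q (- x)).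
Proof.
move=> _ [t t0 ->].
have := qs.1 (x + t *: y) (- x).
rewrite addrAC subrr add0r qs.2 //; lra.
Qed.

Lemma shave_le x t : 0 <= t -> shave q y x <= q (x + t *: y) - t * q y.
Proof. by move=> t0; apply: ge_inf; [exists (- q (- x)) | exists t]. Qed.

Lemma shave_glb x r :
  (forall t, 0 <= t -> r <= q (x + t *: y) - t * q y) -> r <= shave q y x.
Proof.
move=> h; apply: lb_le_inf => [|_ [t t0 ->]]; last exact: h.
by exists (q (x + 0 *: y) - 0 * q y); exists 0.
Qed.

Lemma shave_below x : shave q y x <= q x.
Proof. by have := @shave_le x 0 (lexx 0); rewrite scale0r addr0 mul0r subr0. Qed.

Lemma shave_opp : shave q y (- y) <= - q y.
Proof.
have := @shave_le (- y) 1 ler01.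
by rewrite scale1r addNr (sublinear0 qs) mul1r sub0r.
Qed.

(** Parameters [t] and [s] for two vectors combine to [t + s] for their sum, and [t] for [x] becomes
    [a * t] for [a *: x]. *)
Lemma shave_sublinear : sublinear (shave q y).
Proof.
split=> [u v|].
  rewrite -lerBlDr; apply: shave_glb => t t0; rewrite lerBlDr -lerBlDl.
  apply: shave_glb => s s0; rewrite lerBlDl.
  apply: le_trans (@shave_le _ (t + s) (addr_ge0 t0 s0)) _.
  have := qs.1 (u + t *: y) (v + s *: y).
  by rewrite addrACA -scalerDl; lra.
apply: sublinear_scale_le.
  apply/eqP; rewrite eq_le; apply/andP; split.
    by apply: le_trans (shave_below _) _; rewrite (sublinear0 qs).
  by apply: shave_glb => t t0; rewrite add0r qs.2 // subrr.
move=> a x a0; rewrite -ler_pdivrMl //; apply: shave_glb => t t0.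
rewrite ler_pdivrMl //.
have := @shave_le (a *: x) (a * t) (mulr_ge0 (ltW a0) t0).
by rewrite -scalerA -scalerDr qs.2 ?(ltW a0) // mulrBr mulrA.
Qed.

End Shave.

(** Zorn's lemma for the reversed pointwise order. The infimum of a chain is finite at [x] because
    every member is at least [- p (- x)] there. *)
Lemma minimal_sublinear (p : X -> R) : sublinear p ->
  exists q, [/\ sublinear q, forall x, q x <= p x &
    forall q', sublinear q' -> (forall x, q' x <= q x) -> q' = q].
Proof.
move=> ps.
pose T := {q : X -> R | sublinear q /\ forall x, q x <= p x}.
pose leT (a b : T) := `[< forall x, sval b x <= sval a x >].
have [] := @Zorn T leT.
- by move=> t; apply/asboolP.
- move=> a b c /asboolP ab /asboolP bc; apply/asboolP => x.
  exact: le_trans (bc x) (ab x).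
- move=> a b /asboolP ab /asboolP ba; apply: eq_sig_hprop => [q ? ?|].
    exact: Prop_irrelevance.
  by apply/funext => x; apply/eqP; rewrite eq_le ab ba.
- move=> A totA.
  have [->|/set0P[a0 Aa0]] := eqVneq A set0; first by exists (exist _ p (conj ps (fun=> lexx _))).
  pose E x := [set sval a x | a in A].
  have lbE x : lbound (E x) (- p (- x)).
    move=> _ [a Aa <-]; case: (svalP a) => sa ap.
    by apply: le_trans (sublinear_ge_opp x sa); rewrite lerN2.
  have le_m a x : A a -> inf (E x) <= sval a x.
    by move=> Aa; apply: ge_inf; [exists (- p (- x)) | exists a].
  have glb x r : (forall a, A a -> r <= sval a x) -> r <= inf (E x).
    move=> h; apply: lb_le_inf => [|_ [a Aa <-]]; last exact: h.
    by exists (sval a0 x), a0.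
  have ms : sublinear (fun x => inf (E x)).
    split=> [x y|].
      rewrite -lerBlDr; apply: (glb) => a Aa; rewrite lerBlDr -lerBlDl.
      apply: (glb) => b Ab; rewrite lerBlDl.
      (* Of two members of the chain, the smaller one serves for both [x] and [y]. *)
      have [/asboolP h|/asboolP h] := totA a b Aa Ab.
        apply: le_trans (le_m b _ Ab) _.
        by apply: le_trans ((svalP b).1.1 x y) _; rewrite lerD2r.
      apply: le_trans (@le_m a _ Aa) _.
      by apply: le_trans ((svalP a).1.1 x y) _; rewrite lerD2l.
    apply: sublinear_scale_le => /=.
      apply/eqP; rewrite eq_le; apply/andP; split.
        by apply: le_trans (le_m a0 _ Aa0) _; rewrite (sublinear0 (svalP a0).1).
      by apply: (glb) => a Aa; rewrite (sublinear0 (svalP a).1).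
    move=> c x c0; rewrite -ler_pdivrMl //; apply: (glb) => a Aa.
    by rewrite ler_pdivrMl // -((svalP a).1.2) ?(ltW c0)//; exact: le_m.
  have mp x : inf (E x) <= p x.
    exact: le_trans (le_m a0 x Aa0) ((svalP a0).2 x).
  exists (exist (fun q => sublinear q /\ forall x, q x <= p x) _ (conj ms mp)) => a Aa;
   apply/asboolP => x /=; exact: le_m.
move=> [q [qs qp]] max; exists q; split=> // q' qs' qq'.
have q'p x : q' x <= p x := le_trans (qq' x) (qp x).
by have /(_ _)/(congr1 sval) := max (exist _ q' (conj qs' q'p)); apply; apply/asboolP.
Qed.

(** Take a minimal sublinear functional below [shave p y]. Shaving it further at any [x] changes
    nothing, so it is odd, hence linear. Its value at [- y] is at most [- p y], which forces
    equality at [y]. *)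
Lemma hahn_banach (p : X -> R) (y : X) : sublinear p ->
  exists f : {linear X -> R^o}, (forall x, f x <= p x) /\ f y = p y.
Proof.
move=> ps; have [f [fs fp fmin]] := minimal_sublinear (shave_sublinear y ps).
have fN x : f (- x) = - f x.
  have := fmin _ (shave_sublinear x fs) (fun u => shave_below x fs u).
  move=> e; apply/eqP; rewrite eq_le; apply/andP; split.
    by have := shave_opp x fs; rewrite e.
  by rewrite lerNl; exact: sublinear_ge_opp.
have fD x u : f (x + u) = f x + f u.
  by apply/eqP; rewrite eq_le fs.1 /= -lerN2 opprD -!fN opprD fs.1.
have fZ a x : f (a *: x) = a * f x.
  have [a0|/ltW a0] := leP 0 a; first exact: fs.2.
  have h := fs.2 (- a) x; move: h; rewrite oppr_ge0 => /(_ a0).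
  by rewrite scaleNr fN mulNr => /oppr_inj.
have fl : linear (f : X -> R^o) by move=> a x u; rewrite fD fZ.
pose L := GRing.isLinear.Build _ _ _ _ (f : X -> R^o) fl.
pose g : {linear X -> R^o} := HB.pack (f : X -> R^o) L.
exists g; split=> [x|] /=.
  exact: le_trans (fp x) (shave_below y ps x).
apply/eqP; rewrite eq_le (le_trans (fp _) (shave_below y ps _)) /=.
rewrite -lerN2 -fN.
exact: le_trans (fp _) (shave_opp y ps).
Qed.

End SublinearFunctionals.

(** * A bounded triangular system of vectors and functionals *)

Section BiorthogonalSequence.
Context {R : realType} {X : normedModType R}.

Fixpoint spanned (s : seq X) (x : X) : Prop :=
  if s is v :: s' then exists a : R, spanned s' (x - a *: v) else x = 0.

Lemma spannedD s x y : spanned s x -> spanned s y -> spanned s (x + y).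
Proof.
elim: s x y => [x y /= -> ->|v s IH x y /= [a xa] [b yb]]; first by rewrite addr0.
by exists (a + b); rewrite scalerDl opprD addrACA; exact: IH.
Qed.

Lemma spannedZ s a x : spanned s x -> spanned s (a *: x).
Proof.
elim: s x => [x /= ->|v s IH x /= [b xb]]; first by rewrite scaler0.
by exists (a * b); rewrite -scalerA -scalerBr; exact: IH.
Qed.

Lemma spannedN s x : spanned s x -> spanned s (- x).
Proof. by rewrite -scaleN1r; exact: spannedZ. Qed.

Lemma spanned0 s : spanned s 0.
Proof. by elim: s => //= v s IH; exists 0; rewrite scale0r subr0. Qed.

Lemma spanned_behead v s x : spanned s x -> spanned (v :: s) x.
Proof. by exists 0; rewrite scale0r subr0. Qed.

Lemma spanned_mem s x : x \in s -> spanned s x.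
Proof.
elim: s => // v s IH; rewrite inE => /orP[/eqP->|/IH]; last exact: spanned_behead.
by exists 1; rewrite scale1r subrr; exact: spanned0.
Qed.

Lemma spanned_sum s x : spanned s x ->
  exists c : nat -> R, x = \sum_(i < size s) c i *: s`_i.
Proof.
elim: s x => [x /= ->|v s IH x /= [a /IH[c hc]]].
  by exists (fun=> 0); rewrite big_ord0.
exists (fun i => if i is j.+1 then c j else a).
by rewrite big_ord_recl /= -hc addrC subrK.
Qed.

Definition dist (s : seq X) (x : X) : R := inf [set `|x - u| | u in spanned s].

Lemma dist_le_norm s x u : spanned s u -> dist s x <= `|x - u|.
Proof. by move=> su; apply: ge_inf; [exists 0 => _ [v _ <-] | exists u]. Qed.

Lemma le_dist s x r : (forall u, spanned s u -> r <= `|x - u|) -> r <= dist s x.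
Proof.
move=> h; apply: lb_le_inf => [|_ [u su <-]]; last exact: h.
by exists `|x - 0|, 0; first exact: spanned0.
Qed.

Lemma dist_le s x : dist s x <= `|x|.
Proof. by rewrite -[X in _ <= `|X|]subr0; apply: dist_le_norm; exact: spanned0. Qed.

Lemma dist_spanned s u : spanned s u -> dist s u = 0.
Proof.
move=> su; apply/eqP; rewrite eq_le; apply/andP; split.
  by have := dist_le_norm u su; rewrite subrr normr0.
exact: le_dist.
Qed.

Lemma dist_sublinear s : sublinear (dist s).
Proof.
split=> [x y|].
  rewrite -lerBlDr; apply: le_dist => u su; rewrite lerBlDr -lerBlDl.
  apply: le_dist => v sv; rewrite lerBlDl.
  apply: le_trans (dist_le_norm _ (spannedD su sv)) _.
  by rewrite opprD addrACA ler_normD.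
apply: sublinear_scale_le; first exact/dist_spanned/spanned0.
move=> a x a0; rewrite -ler_pdivrMl //; apply: le_dist => u su.
rewrite ler_pdivrMl // -[X in X * `|_|]gtr0_norm // -normrZ scalerBr.
exact/dist_le_norm/spannedZ.
Qed.

Lemma dist_shift s x u : spanned s u -> dist s (x - u) = dist s x.
Proof.
move=> su; have [dD _] := dist_sublinear s.
apply/eqP; rewrite eq_le; apply/andP; split.
  by apply: le_trans (dD _ _) _; rewrite (dist_spanned (spannedN su)) addr0.
rewrite -[X in dist s X <= _](subrK u).
by apply: le_trans (dD _ _) _; rewrite (dist_spanned su) addr0.
Qed.

(** Hahn-Banach with the distance to the span as dominating functional: it is below the norm and
    vanishes on the span. *)
Lemma annihilator s e : exists f : {linear X -> R^o},
  [/\ forall x, `|f x| <= `|x|, f e = dist s e & forall u, spanned s u -> f u = 0].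
Proof.
have [f [fd fe]] := hahn_banach e (dist_sublinear s).
have fle x : f x <= `|x| := le_trans (fd x) (dist_le s x).
exists f; split=> // [x|u su].
  by rewrite ler_norml fle andbT lerNl -linearN -(normrN x) fle.
apply/eqP; rewrite eq_le -{1}(dist_spanned su) fd /=.
by rewrite -lerN2 oppr0 -linearN -(dist_spanned (spannedN su)) fd.
Qed.

(** A bounded projection stands in for closedness of the span: for [u] in the span,
    [u = - P (x - u)] gives [|u| <= C * |x - u|], so [|x| <= (1 + C) * |x - u|]. *)
Lemma dist_gt0 s (P : {linear X -> X}) (C : R) x :
  (forall u, spanned s u -> P u = u) -> (forall x, `|P x| <= C * `|x|) ->
  0 <= C -> P x = 0 -> x != 0 -> 0 < dist s x.
Proof.
move=> Pid PC C0 Px x0.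
apply: (@lt_le_trans _ _ ((1 + C)^-1 * `|x|)).
  by rewrite mulr_gt0 ?invr_gt0 ?normr_gt0// ltr_wpDr.
apply: le_dist => u su; rewrite ler_pdivrMl ?ltr_wpDr//.
have := PC (x - u); rewrite linearB /= Px Pid // sub0r normrN => Cu.
rewrite -[X in `|X| <= _](subrK u) mulrDl mul1r.
by apply: le_trans (ler_normD _ _) _; rewrite lerD2l.
Qed.

(** By induction: unless [v] is already fixed by [P], the residue [v - P v] has positive distance
    [d] to the span of [s]. The annihilating functional with value [d] there then gives the rank-one
    correction of [P] that also fixes [v]. *)
Lemma spanned_complemented s : exists (P : {linear X -> X}) (C : R),
  [/\ 0 <= C, forall x, spanned s (P x), forall u, spanned s u -> P u = u &
      forall x, `|P x| <= C * `|x|].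
Proof.
elim: s => [|v s [P [C [C0 sP Pid PC]]]].
  by exists \0, 0; split=> //= x; rewrite normr0 mul0r.
have [/eqP|vP] := eqVneq (v - P v) 0.
  rewrite subr_eq0 => /eqP vPv; exists P, C; split=> // [x|u [a su]].
    exact/spanned_behead/sP.
  have -> : u = a *: v + (u - a *: v) by rewrite addrC subrK.
  by rewrite linearP /= (Pid _ su) -vPv.
have PP : P (v - P v) = 0 by rewrite linearB /= (Pid (P v)) // subrr.
have d0 := dist_gt0 Pid PC C0 PP vP.
have [f [fn fe f0]] := annihilator s (v - P v).
set d := dist s _ in d0 fe.
pose Q x := P x + (d^-1 * f x) *: (v - P v).
have Ql : linear Q.
  move=> a x y; rewrite /Q [P _]linearP [f _]linearP /= mulrDr scalerDl.
  by rewrite [a *: (_ + _)]scalerDr addrACA scalerA [d^-1 * (a *: _)]mulrCA.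
pose QL := GRing.isLinear.Build _ _ _ _ Q Ql.
pose Q' : {linear X -> X} := HB.pack Q QL.
have fv : f v = d by rewrite -fe linearB /= (f0 (P v)) // subr0.
have Qid u : spanned s u -> Q u = u.
  by move=> su; rewrite /Q (f0 u) // mulr0 scale0r addr0 Pid.
have Qv : Q v = v by rewrite /Q fv mulVf ?gt_eqF// scale1r addrC subrK.
exists Q', (C + d^-1 * `|v - P v|); split=> [|x|u [a su]|x] /=.
- by rewrite addr_ge0 // mulr_ge0 // invr_ge0 ltW.
- exists (d^-1 * f x); rewrite /Q scalerBr addrCA addrAC subrr add0r.
  by apply: spannedD => //; rewrite -scaleNr; exact/spannedZ.
- have -> : u = a *: v + (u - a *: v) by rewrite addrC subrK.
  by rewrite Ql (Qid _ su) Qv.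
- rewrite /Q; apply: le_trans (ler_normD _ _) _; rewrite mulrDl lerD //.
  rewrite normrZ normrM gtr0_norm ?invr_gt0// -!mulrA ler_wpM2l ?invr_ge0 ?(ltW d0)//.
  by rewrite mulrC ler_wpM2l.
Qed.

Lemma infinite_dim_notin s : infinite_dimensional X -> exists x, ~ spanned s x.
Proof.
move=> inf; apply: contrapT => h; apply: inf.
exists (size s), (fun i => s`_i) => x.
have /spanned_sum[c ->] : spanned s x.
  by apply: contrapT => sx; apply: h; exists x.
by exists (fun i => c i).
Qed.

Variables (z : X) (zs : {linear X -> R^o}).
Hypotheses (Xinf : infinite_dimensional X) (zz : zs z = 1) (z1 : `|z| = 1).
Hypothesis zsn : forall x, `|zs x| <= `|x|.

(** Riesz' lemma produces a vector of norm at most 2 at distance 1 from the span; it is then moved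
    into the kernel of [zs]. *)
Lemma riesz_extension (s : seq X) : z \in s ->
  exists p : X * {linear X -> R^o}, [/\ zs p.1 = 0, `|p.1| <= 4,
    forall x, `|p.2 x| <= `|x|, p.2 p.1 = 1 & forall u, u \in s -> p.2 u = 0].
Proof.
move=> sz; have [x sx] := infinite_dim_notin s Xinf.
have [P [C [C0 sP Pid PC]]] := spanned_complemented s.
have xP : x - P x != 0.
  by apply/eqP => /subr0_eq xPx; apply: sx; rewrite xPx.
have PP : P (x - P x) = 0 by rewrite linearB /= (Pid (P x)) // subrr.
have d0 := dist_gt0 Pid PC C0 PP xP.
set d := dist s _ in d0.
(* With tolerance [d] the norm of [x - P x - u] is below [2 * d], whence [|e0| <= 2]. *)
have [|_ [u su <-] ud] := @inf_adherent R [set `|x - P x - u| | u in spanned s] d d0.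
  split; first by exists `|x - P x - 0|, 0; first exact: spanned0.
  by exists 0 => _ [v _ <-].
pose e0 := d^-1 *: (x - P x - u).
(* Since [z] is in the span, this correction keeps the distance; it at most doubles the bound on the
   norm. *)
pose e := e0 - zs e0 *: z.
have sze0 : spanned s (zs e0 *: z) by exact/spannedZ/spanned_mem.
have e02 : `|e0| <= 2.
  rewrite normrZ gtr0_norm ?invr_gt0// ler_pdivrMl //.
  by move: ud; rewrite -/(dist s (x - P x)) -/d => /ltW/le_trans; apply; lra.
have de : dist s e = 1.
  rewrite dist_shift // (dist_sublinear s).2 ?invr_ge0 ?(ltW d0) // dist_shift //.
  by rewrite mulVf ?gt_eqF.
have [f [fn fe f0]] := annihilator s e.
exists (e, f); split=> //=.
- rewrite /e; have -> : zs (e0 - zs e0 *: z) = zs e0 - zs e0 * zs z.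
    by rewrite [LHS]linearB; congr (_ - _); rewrite [LHS]linearZ.
  by rewrite zz mulr1 subrr.
- apply: le_trans (ler_normB _ _) _; rewrite [`|zs e0 *: z|]normrZ z1 mulr1.
  by have := zsn e0; lra.
- by rewrite fe.
- by move=> v /spanned_mem/f0.
Qed.

Lemma biorthogonal_sequence :
  exists (e : nat -> X) (f : nat -> {linear X -> R^o}),
    [/\ forall k, zs (e k) = 0 /\ `|e k| <= 4,
        forall k x, `|f k x| <= `|x|,
        forall k, f k (e k) = 1 /\ f k z = 0 &
        forall i k, (i < k)%N -> f k (e i) = 0].
Proof.
have [next nextP] : {next : seq X -> X * {linear X -> R^o} & forall s,
    z \in s -> [/\ zs (next s).1 = 0, `|(next s).1| <= 4,
    forall x, `|(next s).2 x| <= `|x|, (next s).2 (next s).1 = 1 &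
    forall u, u \in s -> (next s).2 u = 0]}.
  apply: (@choice _ _ (fun s (p : X * {linear X -> R^o}) => z \in s ->
    [/\ zs p.1 = 0, `|p.1| <= 4,
    forall x, `|p.2 x| <= `|x|, p.2 p.1 = 1 & forall u, u \in s -> p.2 u = 0])).
  move=> s; have [/riesz_extension[p hp]|sz] := boolP (z \in s); first by exists p.
  (* A default for lists without [z], which the recursion never meets. *)
  by exists (0, zs).
(* The list carries [z] and all earlier vectors, so each new functional vanishes on them. *)
pose fix st n := if n is m.+1 then (next (st m)).1 :: st m else [:: z].
have stz n : z \in st n by elim: n => [|n IH] /=; rewrite inE ?eqxx ?IH ?orbT.
have ste i k : (i < k)%N -> (next (st i)).1 \in st k.
  elim: k => // k IH; rewrite ltnS leq_eqVlt => /orP[/eqP->|/IH h] /=.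
    by rewrite inE eqxx.
  by rewrite inE h orbT.
exists (fun n => (next (st n)).1), (fun n => (next (st n)).2).
split=> [k|k|k|i k ik]; have [h1 h2 h3 h4 h5] := nextP _ (stz k) => //.
  by split=> //; apply: h5.
by apply: h5; apply: ste.
Qed.

End BiorthogonalSequence.

(** * Flat functions *)

Section FlatFunctions.
Context {R : realType}.
Implicit Types (x y : R) (n : nat).

(** The negative powers make the linear span of this family stable under differentiation. *)
Definition flat n x : R := if 0 < x then x ^- n * expR (- x^-1) else 0.

Lemma flat_pos n x : 0 < x -> flat n x = x ^- n * expR (- x^-1).
Proof. by rewrite /flat => ->. Qed.

Lemma flat_npos n x : x <= 0 -> flat n x = 0.
Proof. by rewrite /flat ltNge => ->. Qed.

Lemma flat_ge0 n x : 0 <= flat n x.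
Proof.
rewrite /flat; case: ltP => // x0.
by rewrite mulr_ge0 ?invr_ge0 ?exprn_ge0 ?expR_ge0// ltW.
Qed.

(** The exponential at [x^-1] dominates the term of degree [m.+1] of its series. *)
Lemma flat_le n m x : 0 < x -> flat n x * x ^+ n <= m.+1`!%:R * x ^+ m.+1.
Proof.
move=> x0; rewrite flat_pos // mulrAC mulVf ?mul1r ?expf_neq0 ?gt_eqF//.
have c0 : 0 < m.+1`!%:R * x ^+ m.+1 :> R.
  by rewrite mulr_gt0 ?exprn_gt0 ?ltr0n ?fact_gt0.
rewrite expRN -[leRHS]invrK lef_pV2 ?posrE ?invr_gt0 ?expR_gt0//.
rewrite invfM mulrC -exprVn.
have x'0 : 0 <= x^-1 by rewrite invr_ge0 ltW.
by apply: le_trans (expR_ge1Dxn m x'0); rewrite lerDr.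
Qed.

Lemma flat_le_fact n x : flat n.+1 x <= n.+1`!%:R.
Proof.
have [x0|x0] := ltP 0 x; last by rewrite flat_npos.
by have := flat_le n.+1 n x0; rewrite ler_pM2r ?exprn_gt0.
Qed.

Lemma flat_quadratic n x : flat n x <= n.+2`!%:R * x ^+ 2.
Proof.
have [x0|x0] := ltP 0 x; last by rewrite flat_npos // mulr_ge0 ?sqr_ge0.
have := flat_le n n.+1 x0.
by rewrite -(addn2 n) exprD mulrCA [X in _ <= X]mulrC ler_pM2r ?exprn_gt0.
Qed.

(** Left of 0 the function is locally zero, right of 0 this is the product rule, and at 0 the bound
    [flat_quadratic] sends the difference quotient to 0. *)
Lemma is_derive_flat n x : is_derive x 1 (flat n) (flat n.+2 x - n%:R * flat n.+1 x).
Proof.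
have [x0|x0|x0] := ltrgtP x 0.
- rewrite !flat_npos ?(ltW x0)// mulr0 subrr.
  apply: (@near_eq_is_derive _ _ _ (cst 0)).
  by near=> y; rewrite flat_npos //; near: y; exact: lt_le_nbhsl.
- rewrite !flat_pos //.
  pose g := (fun y : R => y^-1) ^+ n * (expR \o (- (fun y : R => y^-1))).
  apply: (@near_eq_is_derive _ _ _ g).
    near=> y; rewrite flat_pos; last by near: y; exact: lt_nbhsr.
    by rewrite /g /= -exprVn !fctE.
  have xn0 : x != 0 by rewrite gt_eqF.
  have dV : is_derive x 1 (fun y : R => y^-1) (- x ^- 2 *: 1).
    exact: (@is_deriveV R id x 1 1 xn0 (is_derive_id _ _)).
  have dE := @is_derive1_comp R expR (- (fun y : R => y^-1)) x _ _
    (is_derive_expR _) (is_deriveN dV).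
  apply: is_derive_eq (is_deriveM (is_deriveX n dV) dE) _.
  rewrite !fctE /= /GRing.scale /= !mulr1.
  case: n {g} => [|n]; rewrite /= -!exprVn ?mul0r ?mulr0 ?subr0 ?addr0 !exprS; ring.
- rewrite x0 !flat_npos // mulr0 subrr.
  have dl : h^-1 *: ((flat n \o shift 0) (h *: (1 : R)) - flat n 0) @[h --> 0^'] --> 0.
    apply/cvgr0Pnorm_le => e e0; near=> h.
    have h0 : h != 0 by near: h; exact: nbhs_dnbhs_neq.
    rewrite /= addr0 [h *: _]mulr1 (@flat_npos _ 0) // subr0 normrZ normfV.
    rewrite ler_pdivrMl ?normr_gt0// ger0_norm ?flat_ge0//.
    apply: le_trans (flat_quadratic _ _) _.
    rewrite -real_normK ?num_real// expr2 mulrCA ler_wpM2l // -ler_pdivlMl ?ltr0n ?fact_gt0//.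
    near: h; apply: dnbhs0_le.
    by rewrite mulr_gt0 // invr_gt0 ltr0n fact_gt0.
  by split; [apply/cvg_ex; exists 0 | apply: cvg_lim].
Unshelve. all: by end_near.
Qed.

(** Mean value theorem: the derivative is [flat 2], which is bounded by [2!]. *)
Lemma flat_lipschitz x y : `|flat 0 x - flat 0 y| <= 2 * `|x - y|.
Proof.
wlog xy : x y / x <= y => [h|].
  by have [/h//|/ltW/h] := leP x y; rewrite distrC [`|y - x|]distrC.
have [|c _ e] := @MVT_segment R (flat 0) (fun x => flat 2 x - 0 * flat 1 x) x y xy
  (fun u _ => is_derive_flat 0 u).
  apply: derivable_within_continuous => u _.
  by have [] := is_derive_flat 0 u.
rewrite distrC e mul0r subr0 normrM ger0_norm ?flat_ge0// [`|y - x|]distrC.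
by rewrite ler_wpM2r // (flat_le_fact 1).
Qed.

End FlatFunctions.

(** * A class of functions closed under differentiation *)

Section SmoothTerms.
Context {R : realType} {X : normedModType R}.

Record contraction := Contraction {
  contraction_fun :> {linear X -> R^o};
  contraction_le : forall x, `|contraction_fun x| <= `|x| }.

Lemma contraction_continuous (f : contraction) : continuous f.
Proof.
apply: bounded_linear_continuous; exists 1; split; first exact: num_real.
move=> r r1; near=> x; apply: le_trans (contraction_le f x) _.
apply/ltW/(lt_trans _ r1); near: x; apply/nbhs_normP; exists 1 => //= y.
by rewrite /ball_ /= sub0r normrN.
Unshelve. all: by end_near. Qed.

(** A syntax is used so that derivatives of all orders can be computed by recursion and remain in
    the class. *)
Inductive term :=
| Tlin of contraction
| Tcst of R
| Tadd of term & term
| Tmul of term & term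
| Tflat of nat & term.

Fixpoint ev (p : term) (x : X) : R :=
  match p with
  | Tlin f => f x
  | Tcst c => c
  | Tadd p q => ev p x + ev q x
  | Tmul p q => ev p x * ev q x
  | Tflat n p => flat n (ev p x)
  end.

(* [dl p] lists pairs [(p_i, f_i)] with [D p(x)(h) = \sum_i f_i h * p_i x] *)
Fixpoint dl (p : term) : seq (term * contraction) :=
  match p with
  | Tlin f => [:: (Tcst 1, f)]
  | Tcst c => [::]
  | Tadd p q => dl p ++ dl q
  | Tmul p q => [seq (Tmul q r.1, r.2) | r <- dl p] ++
                [seq (Tmul p r.1, r.2) | r <- dl q]
  | Tflat n p =>
    [seq (Tmul (Tadd (Tflat n.+2 p) (Tmul (Tcst (- n%:R)) (Tflat n.+1 p))) r.1, r.2)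
    | r <- dl p]
  end.

Definition dev (p : term) (x h : X) : R := \sum_(r <- dl p) r.2 h * ev r.1 x.

Lemma ev_diff p x : is_diff x (ev p : X -> R^o) (dev p x).
Proof.
elim: p => [f|c|p IHp q IHq|p IHp q IHq|n p IH].
- have -> : dev (Tlin f) x = f :> (X -> R^o).
    by apply/funext => h; rewrite /dev /= big_seq1 /= mulr1.
  have cf := @contraction_continuous f.
  by split; [exact: linear_differentiable | exact: diff_lin].
- have -> : dev (Tcst c) x = 0 :> (X -> R^o).
    by apply/funext => h; rewrite /dev /= big_nil.
  exact: is_diff_cst.
- have -> : dev (Tadd p q) x = dev p x + dev q x :> (X -> R^o).
    by apply/funext => h; rewrite /dev /= big_cat.
  exact: is_diffD.
- apply: is_diff_eq (is_diffM IHp IHq) _.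
  apply/funext => h; rewrite /dev /= big_cat /= !big_map !fctE /= addrC.
  by rewrite !scaler_sumr; congr (_ + _); apply: eq_bigr => r _; rewrite /GRing.scale /= mulrCA.
- have [dn en] := is_derive_flat n (ev p x).
  have dF : is_diff (ev p x) (flat n : R -> R^o)
      ( *:%R^~ (flat n.+2 (ev p x) - n%:R * flat n.+1 (ev p x))).
    split; first exact/derivable1_diffP.
    by rewrite deriv1E // derive1E en.
  apply: is_diff_eq (is_diff_comp IH dF) _.
  apply/funext => h; rewrite /dev /= big_map /= /GRing.scale /= mulr_suml.
  by apply: eq_bigr => r _; rewrite mulNr -mulrA [ev _ _ * _]mulrC.
Qed.

Lemma ev_taylor p x e : 0 < e -> exists2 d : R, 0 < d &
  forall h : X, `|h| < d -> `|ev p (x + h) - ev p x - dev p x h| <= e * `|h|.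
Proof.
move=> e0; have [dp ep] := ev_diff p x.
have /eqaddoP/(_ e e0)/nbhs_normP[d /= d0 hd] := diff_locally dp.
exists d => // h hlt; have := hd h; rewrite /ball_ /= sub0r normrN => /(_ hlt).
by rewrite ep !fctE /= opprD addrA [h + x]addrC.
Qed.

(* The last argument is consumed by the innermost differentiation. *)
Fixpoint der (n : nat) (p : term) (x : X) {struct n} : ('I_n -> X) -> R :=
  if n is m.+1 return ('I_n -> X) -> R then
    fun v => \sum_(r <- dl p) r.2 (v ord_max) * @der m r.1 x (fun i => v (widen_ord (leqnSn m) i))
  else fun _ => ev p x.
Local Arguments der n p x v : clear implicits.

Lemma der_multilinear n p x : multilinear (der n p x : _ -> R^o).
Proof.
elim: n p => [p v []//|n IH p v i a u w] /=.
rewrite scaler_sumr -big_split /=; apply: eq_bigr => r _.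
have [->|im] := eqVneq i ord_max.
  have updw y : (fun i => upd v ord_max y (widen_ord (leqnSn n) i)) =
                (fun i => v (widen_ord (leqnSn n) i)).
    by apply/funext => j; rewrite /upd -val_eqE /= ltn_eqF.
  rewrite !updw /upd eqxx linearP /= mulrDl.
  by rewrite /GRing.scale /= mulrA.
have ilt : (i < n)%N.
  have := ltn_ord i.
  by rewrite ltnS leq_eqVlt -[X in X || _]/(i == ord_max) (negbTE im).
have updw y : (fun j => upd v i y (widen_ord (leqnSn n) j)) =
              upd (fun j => v (widen_ord (leqnSn n) j)) (Ordinal ilt) y.
  by apply/funext => j; rewrite /upd -!val_eqE.
have updm y : upd v i y ord_max = v ord_max by rewrite /upd eq_sym (negbTE im).
by rewrite !updm !updw IH mulrDr /GRing.scale /= mulrCA.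
Qed.

Lemma der_bounded n p x : exists2 B : R, 0 <= B &
  forall v, (forall i, `|v i| <= 1) -> `|der n p x v| <= B.
Proof.
elim: n p => [p|n IH p]; first by exists `|ev p x|.
suff: forall s : seq (term * contraction), exists2 B : R, 0 <= B &
    forall v : 'I_n.+1 -> X, (forall i, `|v i| <= 1) ->
    `|\sum_(r <- s) r.2 (v ord_max) * der n r.1 x (fun i => v (widen_ord (leqnSn n) i))| <= B.
  by apply.
elim=> [|[q f] s [B B0 hB]]; first by exists 0 => // v _; rewrite big_nil normr0.
have [C C0 hC] := IH q; exists (C + B) => [|v v1]; first exact: addr_ge0.
rewrite big_cons /=; apply: le_trans (ler_normD _ _) _; rewrite lerD ?hB//.
rewrite normrM -[C]mul1r ler_pM // ?hC //.
exact: le_trans (contraction_le f _) (v1 _).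
Qed.

(** With [vcons_widen], this reconciles [smooth_on], which puts the new direction first, with [der],
    which consumes the last one. *)
Lemma vcons_ord_max n (h : X) (v : 'I_n.+1 -> X) : vcons h v ord_max = v ord_max.
Proof.
rewrite /vcons; case: unliftP => [j|] /(congr1 val) //=.
by rewrite /bump /= add1n => -[e]; congr v; apply: val_inj.
Qed.

Lemma vcons_widen n (h : X) (v : 'I_n.+1 -> X) :
  (fun i => vcons h v (widen_ord (leqnSn n.+1) i)) =
  vcons h (fun i => v (widen_ord (leqnSn n) i)).
Proof.
apply/funext => i; rewrite /vcons.
case: unliftP => [j|] /(congr1 val) /=; case: unliftP => [k|] /(congr1 val) /= -> //=.
by rewrite /bump /= !add1n => -[e]; congr v; apply: val_inj.
Qed.

(** The factor [r.2 (v ord_max)] does not depend on the base point, so the remainder at order [n.+1]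
    is a sum of remainders at order [n] for the terms in [dl p]. *)
Lemma der_taylor n p x e : 0 < e -> exists2 d : R, 0 < d &
  forall h : X, `|h| < d -> forall v, (forall i, `|v i| <= 1) ->
  `|der n p (x + h) v - der n p x v - der n.+1 p x (vcons h v)| <= e * `|h|.
Proof.
elim: n p e => [p e e0|n IH p e e0].
  have [d d0 hd] := ev_taylor p x e0; exists d => // h /hd H v _ /=.
  have -> // : \sum_(r <- dl p) r.2 (vcons h v ord_max) * ev r.1 x = dev p x h.
  apply: eq_bigr => r _; congr (r.2 _ * _).
  by rewrite /vcons; case: unliftP => [[]|].
(* The tolerance is shared among the entries of [dl p]; the successor covers the empty list. *)
have e1 (m : nat) : 0 < e / m.+1%:R by rewrite divr_gt0.
have step (s : seq (term * contraction)) : exists2 d : R, 0 < d &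
  forall h : X, `|h| < d -> forall v : 'I_n.+1 -> X, (forall i, `|v i| <= 1) ->
  `|\sum_(r <- s) r.2 (v ord_max) * (der n r.1 (x + h) (fun i => v (widen_ord (leqnSn n) i))
     - der n r.1 x (fun i => v (widen_ord (leqnSn n) i))
     - der n.+1 r.1 x (vcons h (fun i => v (widen_ord (leqnSn n) i))))| <=
   (size s)%:R * (e / (size (dl p)).+1%:R) * `|h|.
  elim: s => [|[q f] s [d d0 hd]].
    by exists 1 => // h _ v _; rewrite big_nil normr0 !mul0r.
  have [c c0 hc] := IH q _ (e1 (size (dl p))).
  exists (Order.min c d) => [|h]; first by rewrite lt_min c0.
  rewrite lt_min => /andP[hhc hhd] v v1; rewrite big_cons /=.
  apply: le_trans (ler_normD _ _) _.
  rewrite -(natr1 (size s)) addrC !mulrDl lerD ?hd //.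
  rewrite mul1r normrM; apply: le_trans (ler_wpM2r (normr_ge0 _) (contraction_le f _)) _.
  apply: le_trans (ler_wpM2r (normr_ge0 _) (v1 _)) _; rewrite mul1r.
  by apply: hc => // i; exact: v1.
have [d d0 hd] := step (dl p); exists d => // h hh v v1.
have := hd h hh v v1.
rewrite (eq_bigr (fun r : term * contraction =>
  r.2 (v ord_max) * der n r.1 (x + h) (fun i => v (widen_ord (leqnSn n) i)) -
  r.2 (v ord_max) * der n r.1 x (fun i => v (widen_ord (leqnSn n) i)) -
  r.2 (vcons h v ord_max) *
    der n.+1 r.1 x (fun i => vcons h v (widen_ord (leqnSn n.+1) i)))); last first.
  by move=> r _; rewrite vcons_ord_max vcons_widen !mulrBr.
rewrite !sumrB => /le_trans; apply; rewrite ler_wpM2r //.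
by rewrite mulrCA ger_pMr // ler_pdivrMr ?mul1r ?ler_nat.
Qed.

End SmoothTerms.
Arguments der {R X} n p x v.

(** * Smoothness on a set *)

Section SmoothOn.
Context {R : realType}.

Lemma mnorm_leP {V W : normedModType R} {n : nat} (A : ('I_n -> V) -> W) (c : R) :
  (mnorm A <= c%:E)%E <-> forall v, (forall i, `|v i| <= 1) -> `|A v| <= c.
Proof.
split=> [h v v1|h].
  by rewrite -lee_fin; apply: le_trans h; apply: ereal_sup_ubound; exists v.
by apply: ge_ereal_sup => _ [v v1 <-]; rewrite lee_fin; exact: h.
Qed.

(** The body of [smooth_on] with the family of derivatives as a parameter, so that two families can
    be compared. *)
Definition jet {V W : normedModType R} (U : set V) (f : V -> W)
    (D : forall n : nat, V -> ('I_n -> V) -> W) : Prop :=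
  (forall x v, U x -> D 0%N x v = f x) /\
  (forall n x, U x -> multilinear (D n x) /\ (mnorm (D n x) < +oo)%E) /\
  (forall n x, U x -> forall e : R, 0 < e -> exists2 d : R, 0 < d &
      forall h : V, `|h| < d -> U (x + h) ->
        (mnorm (fun v => (D n (x + h) v - D n x v - D n.+1 x (vcons h v))%R)
          <= (e * `|h|)%:E)%E).

Definition has_balls {V : normedModType R} (U : set V) : Prop :=
  forall x, U x -> exists2 d : R, 0 < d & forall h, `|h| < d -> U (x + h).

Lemma has_balls_open {V : normedModType R} (U : set V) : has_balls U <-> open U.
Proof.
rewrite openE; split=> [h x /h[d d0 hd]|h x /h].
  apply/nbhs_normP; exists d => // y; rewrite /ball_ /= distrC => /hd.
  by rewrite addrC subrK.
move=> /nbhs_normP[d /= d0 hd]; exists d => // k kd; apply: hd.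
by rewrite /ball_ /= opprD addrA subrr sub0r normrN.
Qed.

Variables V W : normedModType R.

Lemma multilinear_vconsZ n (A : ('I_n.+1 -> V) -> W) (t : R) (h : V) (v : 'I_n -> V) :
  multilinear A -> A (vcons (t *: h) v) = t *: A (vcons h v).
Proof.
move=> Am.
have updE u w : upd (vcons u v) ord0 w = vcons w v.
  apply/funext => j; rewrite /upd /vcons.
  by case: unliftP => [k ->|->]; rewrite ?eqxx // eq_sym (negbTE (neq_lift _ _)).
have A0 : A (vcons 0 v) = 0.
  have := Am (vcons h v) ord0 1 0 0; rewrite !updE scaler0 addr0 scale1r => e.
  by apply: (@addrI _ (A (vcons 0 v))); rewrite addr0 -e.
by have := Am (vcons h v) ord0 t h 0; rewrite !updE A0 !addr0.
Qed.

(** Two derivatives of the same map on an open set agree: compare the Taylor estimates at [t *: h]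
    for small [t] and divide by [t]. *)
Lemma jet_unique (U : set V) (f g : V -> W) D D' :
  has_balls U -> jet U f D -> jet U g D' -> (forall x, U x -> f x = g x) ->
  forall n x v, U x -> (forall i, `|v i| <= 1) -> D n x v = D' n x v.
Proof.
move=> Uo [D0 [Dm DT]] [D'0 [D'm D'T]] fg.
elim=> [x v Ux _|n IH x w Ux w1]; first by rewrite D0 // D'0 // fg.
have [h [v [ew h1 v1]]] : exists h v, [/\ w = vcons h v, `|h| <= 1 & forall i, `|v i| <= 1].
  exists (w ord0), (fun i => w (lift ord0 i)); split=> //.
  by apply/funext => j; rewrite /vcons; case: unliftP => [k ->|->].
rewrite ew {w w1 ew}; apply/eqP; rewrite -subr_eq0 -normr_le0; apply/ler_addgt0Pl => e e0.
rewrite addr0.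
have e20 : 0 < e / 2 by rewrite divr_gt0.
have [d d0 hd] := DT n x Ux _ e20; have [d' d'0 hd'] := D'T n x Ux _ e20.
have [c c0 hc] := Uo x Ux.
pose m := Order.min d (Order.min d' c).
have m0 : 0 < m by rewrite !lt_min d0 d'0.
pose t := m / 2; have t0 : 0 < t by rewrite divr_gt0.
have th : `|t *: h| <= t by rewrite normrZ gtr0_norm // ger_pMr.
have : `|t *: h| < m by apply: le_lt_trans th _; rewrite /t; lra.
rewrite /m !lt_min => /andP[td /andP[td' tc]].
have Uh := hc _ tc.
have /mnorm_leP/(_ v v1) := hd _ td Uh; have /mnorm_leP/(_ v v1) := hd' _ td' Uh.
rewrite !multilinear_vconsZ; try exact: (Dm _ _ _).1; try exact: (D'm _ _ _).1.
rewrite (IH _ v Uh) // (IH _ v Ux) //.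
set a := D' n (x + t *: h) v - D' n x v.
move=> H' H.
(* By induction both estimates concern the same increment [a]. *)
have : `|t *: (D n.+1 x (vcons h v) - D' n.+1 x (vcons h v))| <= e * t.
  have -> : t *: (D n.+1 x (vcons h v) - D' n.+1 x (vcons h v)) =
    (a - t *: D' n.+1 x (vcons h v)) - (a - t *: D n.+1 x (vcons h v)).
    by rewrite scalerBr opprB [RHS]addrC addrA subrK.
  apply: le_trans (ler_normB _ _) _.
  apply: le_trans (lerD H' H) _.
  by rewrite -mulrDl -splitr ler_wpM2l // ltW.
by rewrite normrZ gtr0_norm // mulrC ler_pM2r.
Qed.

(** Choose a local family of derivatives around each point and let the one chosen at [x] decide the
    value at [x]; uniqueness makes these choices compatible. *)
Lemma smooth_on_local (U : set V) (f : V -> W) :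
  (forall x, U x -> exists B : set V, [/\ has_balls B, B x, B `<=` U & smooth_on B f]) ->
  smooth_on U f.
Proof.
move=> loc.
have /choice[BD BDP] : forall x, exists BD : set V * (forall n : nat, V -> ('I_n -> V) -> W),
    U x -> [/\ has_balls BD.1, BD.1 x, BD.1 `<=` U & jet BD.1 f BD.2].
  move=> x; have [/loc[B [Bo Bx BU [D jD]]]|nU] := pselect (U x).
    by exists (B, D).
  by exists (set0, fun _ _ _ => 0).
exists (fun n x => (BD x).2 n x); split=> [x v Ux|].
  by have [_ Bx _ [j0 _]] := BDP x Ux; exact: j0.
split=> [n x Ux|n x Ux e e0].
  by have [_ Bx _ [_ [jm _]]] := BDP x Ux; exact: jm.
have [Bo Bx BU jD] := BDP x Ux; have [_ [_ jT]] := jD.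
have [d d0 hd] := jT n x Bx e e0; have [c c0 hc] := Bo x Bx.
exists (Order.min d c) => [|h]; first by rewrite lt_min d0.
rewrite lt_min => /andP[hhd hhc] Uh; have Bh := hc _ hhc.
have /mnorm_leP hT := hd _ hhd Bh; apply/mnorm_leP => v v1; have := hT v v1.
(* The derivative at [x + h] comes from another neighbourhood; the two families agree on the
   intersection. *)
suff -> : (BD (x + h)).2 n (x + h) v = (BD x).2 n (x + h) v by [].
have [Bo' Bx' BU' jD'] := BDP _ Uh.
have sub (A B : set V) (g : V -> W) D : A `<=` B -> jet B g D -> jet A g D.
  move=> AB [h0 [h1 h2]]; split; first by move=> y w /AB; exact: h0.
  split=> [m y /AB|m y Ay eps eps0]; first exact: h1.
  have [r r0 hr] := h2 m y (AB _ Ay) eps eps0.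
  by exists r => // k kr /AB; exact: hr.
apply: (@jet_unique ((BD (x + h)).1 `&` (BD x).1) f f) => //.
- move=> y [y1 y2]; have [r r0 hr] := Bo' y y1; have [s s0 hs] := Bo y y2.
  exists (Order.min r s) => [|k]; first by rewrite lt_min r0.
  by rewrite lt_min => /andP[kr ks]; split; [exact: hr|exact: hs].
- by apply: sub jD' => y [].
- by apply: sub jD => y [].
Qed.

Lemma eq_smooth_on (U B : set V) (f g : V -> W) : B `<=` U ->
  (forall x, B x -> f x = g x) -> smooth_on U f -> smooth_on B g.
Proof.
move=> BU fg [D [h0 [h1 h2]]]; exists D; split=> [x v Bx|].
  by rewrite h0 ?fg //; exact: BU.
split=> [n x /BU|n x Bx e e0]; first exact: h1.
have [d d0 hd] := h2 n x (BU _ Bx) e e0.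
by exists d => // h hh /BU; exact: hd.
Qed.

End SmoothOn.

(** * Smoothness of a multiple of the identity plus a finite-rank perturbation *)

Section VectorTerms.
Context {R : realType} {X : normedModType R}.
Implicit Types (a : R) (s : seq (@term R X * X)).

(** The common shape of the folding map and of its inverse on one piece of the tube. *)
Definition vev a s (x : X) : X := a *: x + \sum_(r <- s) ev r.1 x *: r.2.

Lemma differentiable_vev a s x : differentiable (vev a s) x.
Proof.
have -> : vev a s = ( *:%R a) + (fun x => \sum_(r <- s) ev r.1 x *: r.2) by [].
apply: differentiableD; first exact: ex_diff.
elim: s => [|[p e] s IH].
  have -> : (fun y : X => \sum_(r <- [::]) ev r.1 y *: r.2) = cst (0 : X).
    by apply/funext => y; rewrite big_nil.
  exact: differentiable_cst.
have -> : (fun y : X => \sum_(r <- (p, e) :: s) ev r.1 y *: r.2) =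
   (fun y => ev p y *: e) + (fun y => \sum_(r <- s) ev r.1 y *: r.2).
  by apply/funext => y; rewrite big_cons.
apply: differentiableD IH; apply: differentiableZl.
by have [] := ev_diff p x.
Qed.

Definition vder a s (n : nat) (x : X) (v : 'I_n -> X) : X :=
  (match n return ('I_n -> X) -> X with
   | 0 => fun _ => a *: x
   | 1 => fun v => a *: v ord0
   | _ => fun _ => 0 end) v + \sum_(r <- s) der n r.1 x v *: r.2.

Arguments vder a s n x v : clear implicits.

Lemma smooth_on_vev a s (U : set X) : smooth_on U (vev a s).
Proof.
exists (vder a s); split=> // ; split=> [n x _|n x _ e e0].
  split=> [v i b u w|].
    rewrite /vder scalerDr addrACA; congr (_ + _).
      case: n v i => [v []//|[|n] v i]; last by rewrite scaler0 addr0.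
      have -> : ord0 = i by apply: val_inj; case: i => [[]].
      by rewrite /upd eqxx scalerDr !scalerA [b * a]mulrC.
    rewrite scaler_sumr -big_split /=; apply: eq_bigr => r _.
    by rewrite (der_multilinear r.1 x v i b u w) scalerDl scalerA.
  suff [B hB] : exists B : R, (mnorm (vder a s n x) <= B%:E)%E.
    exact: le_lt_trans hB (ltry _).
  have [B hB] : exists B : R, forall v : 'I_n -> X, (forall i, `|v i| <= 1) ->
      `|\sum_(r <- s) der n r.1 x v *: r.2| <= B.
    elim: s => [|[p y] s [B hB]]; first by exists 0 => v _; rewrite big_nil normr0.
    have [C C0 hC] := der_bounded n p x.
    exists (C * `|y| + B) => v v1; rewrite big_cons; apply: le_trans (ler_normD _ _) _.
    by rewrite lerD ?hB // normrZ ler_wpM2r ?hC.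
  exists (`|a *: x| + `|a| + B); apply/mnorm_leP => v v1.
  apply: le_trans (ler_normD _ _) _; rewrite lerD ?hB //.
  case: n v v1 {hB} => [v _|[v v1|n v _]]; first by rewrite lerDl.
    rewrite [`|_ *: v _|]normrZ; apply: le_trans (ler_wpM2l _ (v1 _)) _ => //.
    by rewrite mulr1 lerDr.
  by rewrite normr0 addr_ge0.
have [d d0 hd] : exists2 d : R, 0 < d & forall h, `|h| < d ->
    forall v : 'I_n -> X, (forall i, `|v i| <= 1) ->
    `|\sum_(r <- s) (der n r.1 (x + h) v - der n r.1 x v -
                     der n.+1 r.1 x (vcons h v)) *: r.2| <= e * `|h|.
  elim: s e e0 => [|[p y] s IH] e e0.
    by exists 1 => // h _ v _; rewrite big_nil normr0 mulr_ge0 // ltW.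
  have e2 : 0 < e / 2 by rewrite divr_gt0.
  (* Half of the tolerance goes to this summand, corrected for the length of its vector [y], which
     may be 0. *)
  have ey : 0 < e / 2 / (1 + `|y|) by rewrite divr_gt0 // ltr_wpDr.
  have [d d0 hd] := IH _ e2; have [c c0 hc] := der_taylor n p x ey.
  exists (Order.min d c) => [|h]; first by rewrite lt_min d0.
  rewrite lt_min => /andP[hhd hhc] v v1; rewrite big_cons /=.
  apply: le_trans (ler_normD _ _) _; rewrite [e]splitr mulrDl lerD ?hd // normrZ.
  apply: le_trans (ler_wpM2r (normr_ge0 _) (hc _ hhc _ v1)) _.
  rewrite mulrAC ler_wpM2r // mulrAC ler_pdivrMr ?ltr_wpDr //.
  by rewrite ler_wpM2l ?(ltW e2) // lerDr.
exists d => // h hh _; apply/mnorm_leP => v v1.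
apply: le_trans _ (hd h hh v v1).
under eq_bigr do rewrite !scalerBl.
rewrite !sumrB /vder le_eqVlt; apply/orP; left; apply/eqP; congr `|_|.
(* The part [a *: x] leaves no remainder: it cancels at orders 0 and 1 and is absent above. *)
case: n v v1 {hd} => [v v1|[v v1|n v v1]].
- rewrite [vcons h v ord0](_ : _ = h); last first.
    by rewrite /vcons; case: unliftP => [[]|].
  rewrite scalerDr -[a *: x + _ + _]addrA opprD addrACA subrr add0r -[a *: h + _ - _]addrA.
  by rewrite opprD addrACA subrr add0r.
- by rewrite add0r opprD addrACA subrr add0r.
- by rewrite !add0r.
Qed.

End VectorTerms.

(** * Derivative bounds from a globally Lipschitz local model *)

Section LocalDifferentiability.
Context {R : realType} {V W : normedModType R}.

(** As [f] and [g] agree near [x], the differential of [g] also expands [f]. Its norm is bounded by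
    testing the Lipschitz estimate on [t *: v] with [t] small and dividing by [t]. *)
Lemma differentiable_lipschitz (U : set V) (f g : V -> W) (L : R) (x : V) :
  has_balls U -> U x -> (forall y, U y -> f y = g y) -> differentiable g x ->
  (forall a b, `|g a - g b| <= L * `|a - b|) -> 0 <= L ->
  differentiable f x /\ (opnorm ('d f x) <= L%:E)%E.
Proof.
move=> Uo Ux fg dg gL L0.
have gT e : 0 < e -> exists2 d : R, 0 < d & forall h, `|h| < d ->
    `|g (x + h) - g x - 'd g x h| <= e * `|h|.
  move=> e0; have /eqaddoP/(_ e e0)/nbhs_normP[d /= d0 hd] := diff_locally dg.
  exists d => // h hh; have := hd h; rewrite /ball_ /= sub0r normrN => /(_ hh).
  by rewrite !fctE /= opprD addrA [h + x]addrC.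
have cg := diff_continuous dg.
have fT : f \o shift x = cst (f x) + 'd g x +o_ (0 : V) id.
  apply/eqaddoP => e e0; have [d d0 hd] := gT e e0; have [c c0 hc] := Uo x Ux.
  apply/nbhs_normP; exists (Order.min d c) => /=; first by rewrite lt_min d0.
  move=> h; rewrite /ball_ /= sub0r normrN lt_min => /andP[hhd hhc].
  rewrite !fctE /= opprD addrA [h + x]addrC (fg _ Ux) fg; last exact: hc.
  exact: hd.
have dfE := diff_unique cg fT.
have df : differentiable f x.
  by apply/diff_locallyP; rewrite dfE; split.
split=> //; apply: ge_ereal_sup => _ [v v1 <-]; rewrite lee_fin dfE.
have v1' : `|v| <= 1 by [].
apply/ler_addgt0Pl => e e0; have [d d0 hd] := gT e e0.
pose t := d / 2; have t0 : 0 < t by rewrite divr_gt0.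
have tv : `|t *: v| <= t by rewrite normrZ gtr0_norm // ger_pMr.
have /hd hT : `|t *: v| < d by apply: le_lt_trans tv _; rewrite /t; lra.
have hL := gL (x + t *: v) x; rewrite addrAC subrr add0r in hL.
have : `|'d g x (t *: v)| <= (e + L) * t.
  rewrite -[X in `|X|](subrK (g (x + t *: v) - g x)) addrC.
  apply: le_trans (ler_normD _ _) _; rewrite addrC mulrDl distrC lerD //.
    by apply: le_trans hT _; rewrite ler_wpM2l // ltW.
  by apply: le_trans hL _; rewrite ler_wpM2l.
by rewrite linearZ /= normrZ gtr0_norm // mulrC ler_pM2r.
Qed.

End LocalDifferentiability.

(** * Step functions *)

Section StepFunctions.
Context {R : realType}.
Implicit Types (x y s : R).

(** A smooth step without quotients, which [term] does not offer. For [x <= 0] the inner bracket is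
    1, where [flat 0] is the inverse of [expR 1]; for [1 <= x] it is nonpositive, where [flat 0]
    vanishes. *)
Definition step x : R := 1 + - expR 1 * flat 0 (1 + - expR 1 * flat 0 x).

Definition step_lip : R := 4 * expR 1 * expR 1.

Lemma step_lip_ge0 : 0 <= step_lip.
Proof. by rewrite /step_lip !mulr_ge0 ?expR_ge0. Qed.

Lemma flat0_pos x : 0 < x -> flat 0 x = expR (- x^-1).
Proof. by move=> x0; rewrite flat_pos // expr0 invr1 mul1r. Qed.

Lemma step_le0 x : x <= 0 -> step x = 0.
Proof.
move=> x0; rewrite /step (flat_npos _ x0) mulr0 addr0 flat0_pos // invr1.
by rewrite expRN mulNr mulfV ?subrr // gt_eqF // expR_gt0.
Qed.

Lemma step_ge1 x : 1 <= x -> step x = 1.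
Proof.
move=> x1; have x0 : 0 < x by apply: lt_le_trans x1.
rewrite /step [flat 0 (1 + _)]flat_npos ?mulr0 ?addr0 // flat0_pos // mulNr -expRD.
by rewrite subr_le0 -[leLHS]expR0 ler_expR subr_ge0 invf_le1.
Qed.

Lemma step_le1 x : step x <= 1.
Proof. by rewrite /step mulNr gerBl mulr_ge0 ?expR_ge0 ?flat_ge0. Qed.

Lemma step_ge0 x : 0 <= step x.
Proof.
rewrite /step mulNr subr_ge0.
set y := 1 + _; have y1 : y <= 1 by rewrite /y mulNr gerBl mulr_ge0 ?expR_ge0 ?flat_ge0.
have [y0|y0] := ltP 0 y; last by rewrite flat_npos // mulr0.
by rewrite flat0_pos // -expRD -[leRHS]expR0 ler_expR subr_le0 invf_ge1.
Qed.

Lemma step_lipschitz x y : `|step x - step y| <= step_lip * `|x - y|.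
Proof.
have aux (a b : R) : `|(1 + - expR 1 * a) - (1 + - expR 1 * b)| = expR 1 * `|a - b|.
  by rewrite opprD addrACA subrr add0r -mulrBr normrM normrN [`|expR 1|]ger0_norm ?expR_ge0.
rewrite /step aux.
have h1 := flat_lipschitz (1 + - expR 1 * flat 0 x) (1 + - expR 1 * flat 0 y).
rewrite aux in h1; have h2 := flat_lipschitz x y.
apply: le_trans (ler_wpM2l (expR_ge0 _) h1) _.
rewrite /step_lip; apply: le_trans (_ : _ <= expR 1 * (2 * (expR 1 * (2 * `|x - y|)))) _.
  by rewrite ler_wpM2l ?expR_ge0 // ler_wpM2l // ler_wpM2l ?expR_ge0.
by rewrite le_eqVlt; apply/orP; left; apply/eqP; ring.
Qed.

(** A bump equal to 1 up to distance 1/2 from 0 and to 0 from distance 3/4 on. Of two unit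
    translates, one rises to 1 before the other leaves 1. *)
Definition plateau s : R := step (4 * s + 3) * step (- 4 * s + 3).

Lemma plateau_ge0 s : 0 <= plateau s.
Proof. by rewrite mulr_ge0 ?step_ge0. Qed.

Lemma plateau_le1 s : plateau s <= 1.
Proof. by rewrite mulr_ile1 ?step_ge0 ?step_le1. Qed.

Lemma plateau1 s : - 2^-1 <= s <= 2^-1 -> plateau s = 1.
Proof. by move=> h; rewrite /plateau !step_ge1 ?mul1r //; lra. Qed.

Lemma plateau0l s : s <= - (3 / 4) -> plateau s = 0.
Proof. by move=> h; rewrite /plateau step_le0 ?mul0r //; lra. Qed.

Lemma plateau0r s : 3 / 4 <= s -> plateau s = 0.
Proof. by move=> h; rewrite /plateau [X in _ * X]step_le0 ?mulr0 //; lra. Qed.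

Lemma normB_mul_le (a b c d : R) : `|b| <= 1 -> `|c| <= 1 ->
  `|a * b - c * d| <= `|a - c| + `|b - d|.
Proof.
move=> b1 c1; have -> : a * b - c * d = (a - c) * b + c * (b - d) by ring.
by apply: le_trans (ler_normD _ _) _; rewrite !normrM lerD // ?ler_piMr ?ler_piMl.
Qed.

Lemma plateau_lipschitz s t : `|plateau s - plateau t| <= 8 * step_lip * `|s - t|.
Proof.
have step1 x : `|step x| <= 1 by rewrite ger0_norm ?step_ge0 ?step_le1.
apply: le_trans (normB_mul_le _ _ (step1 _) (step1 _)) _.
apply: le_trans (lerD (step_lipschitz _ _) (step_lipschitz _ _)) _.
have -> : 4 * s + 3 - (4 * t + 3) = 4 * (s - t) by ring.
have -> : - 4 * s + 3 - (- 4 * t + 3) = - (4 * (s - t)) by ring.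
rewrite normrN normrM (ger0_norm (ler0n _ 4)) le_eqVlt.
by apply/orP; left; apply/eqP; move: step_lip => l; ring.
Qed.

Definition ramp x : R := step (3 * x + -1).

Lemma ramp0 x : x <= 3^-1 -> ramp x = 0.
Proof. by move=> h; rewrite /ramp step_le0 //; lra. Qed.

Lemma ramp1 x : 2 / 3 <= x -> ramp x = 1.
Proof. by move=> h; rewrite /ramp step_ge1 //; lra. Qed.

Lemma ramp_ge0 x : 0 <= ramp x.
Proof. exact: step_ge0. Qed.

Lemma ramp_le1 x : ramp x <= 1.
Proof. exact: step_le1. Qed.

Lemma ramp_lipschitz x y : `|ramp x - ramp y| <= 3 * step_lip * `|x - y|.
Proof.
apply: le_trans (step_lipschitz _ _) _.
have -> : 3 * x + -1 - (3 * y + -1) = 3 * (x - y) by ring.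
by rewrite normrM ger0_norm // mulrA [step_lip * 3]mulrC.
Qed.

Context {X : normedModType R}.

Definition Tstep (p : @term R X) : term :=
  let q p := Tadd (Tcst 1) (Tmul (Tcst (- expR 1)) (Tflat 0 p)) in q (q p).
Definition Taff (a b : R) (p : @term R X) : term := Tadd (Tmul (Tcst a) p) (Tcst b).
Definition Tplateau (p : @term R X) : term :=
  Tmul (Tstep (Taff 4 3 p)) (Tstep (Taff (- 4) 3 p)).
Definition Tramp (p : @term R X) : term := Tstep (Taff 3 (-1) p).

Lemma ev_Tplateau p (w : X) : ev (Tplateau p) w = plateau (ev p w).
Proof. by []. Qed.

Lemma ev_Tramp p (w : X) : ev (Tramp p) w = ramp (ev p w).
Proof. by []. Qed.

End StepFunctions.

(** * The folded tube *)

Local Opaque plateau ramp step_lip.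

Lemma hundredth_lt (R : realType) : 100^-1 < 91 / 100 :> R.
Proof. by lra. Qed.

Section Tube.
Context {R : realType} {X : normedModType R}.
Variables (z : X) (zs : {linear X -> R^o}).
Hypotheses (zsz : zs z = 1) (z1 : `|z| = 1) (zs_le : forall x, `|zs x| <= `|x|).
Variables (e : nat -> X) (f : nat -> {linear X -> R^o}).
Hypotheses (zse : forall k, zs (e k) = 0) (e_le : forall k, `|e k| <= 4).
Hypotheses (f_le : forall k x, `|f k x| <= `|x|) (fe : forall k, f k (e k) = 1).
Hypotheses (fz : forall k, f k z = 0).
Hypothesis (fe0 : forall i k, (i < k)%N -> f k (e i) = 0).

Let zs_comb (a b : R) i j : zs (a *: e i + b *: e j) = 0.
Proof. by rewrite linearD !linearZ !zse /= !scaler0 addr0. Qed.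

Let comb_le (a b : R) i j : `|a *: e i + b *: e j| <= `|a| * 4 + `|b| * 4.
Proof.
by apply: le_trans (ler_normD _ _) _; rewrite !normrZ lerD // ler_wpM2l.
Qed.

Let comb_dist (a b a' b' : R) i j :
  `|(a *: e i + b *: e j) - (a' *: e i + b' *: e j)| <= `|a - a'| * 4 + `|b - b'| * 4.
Proof. by rewrite opprD addrACA -!scalerBl. Qed.

Let f_comb (a b : R) k : f k.+1 (a *: e k + b *: e k.+1) = b.
Proof. by rewrite linearD !linearZ fe fe0 //= scaler0 add0r [_ *: _]mulr1. Qed.

Let f_comb_later (a b : R) i k : (k.+1 < i)%N -> f i (a *: e k + b *: e k.+1) = 0.
Proof.
by move=> ki; rewrite linearD !linearZ (fe0 ki) (fe0 (ltnW ki)) /= !scaler0 addr0.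
Qed.

Let f_comb_head (a b : R) k : f k (a *: e k + b *: e k.+1) = a + b * f k (e k.+1).
Proof. by rewrite linearD !linearZ fe /= [a *: _]mulr1. Qed.

Let shear_dist (a b : R) (x y : X) : `|(x + a *: z) - (y + b *: z)| <= `|x - y| + `|a - b|.
Proof.
rewrite opprD addrACA -scalerBl; apply: le_trans (ler_normD _ _) _.
by rewrite lerD2l normrZ z1 mulr1.
Qed.

Let shear_sub_dist (a b : R) (x y : X) : `|(x - a *: z) - (y - b *: z)| <= `|x - y| + `|a - b|.
Proof.
by have := shear_dist (- a) (- b) x y; rewrite !scaleNr -opprD normrN.
Qed.

Let roll_expand (c a b h : R) (w x y : X) :
  c *: (w + (a *: x + b *: y) - h *: z) =
  c *: w + ((c * a) *: x + ((c * b) *: y + (- c * h) *: z)).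
Proof. by rewrite scalerBr !scalerDr !scalerA -!addrA mulNr scaleNr. Qed.

Let unroll_expand (c a b h : R) (w x y : X) :
  c *: w + h *: z - (a *: x + b *: y) =
  c *: w + (h *: z + ((- 1 * a) *: x + (- 1 * b) *: y)).
Proof. by rewrite !mulN1r !scaleNr opprD -!addrA. Qed.

Let scale_tenth (x y : X) : 10^-1 *: x = 10^-1 *: y :> X -> x = y.
Proof. by apply: scalerI; rewrite invr_eq0. Qed.

Let shear_eq (a b : R) (x y : X) : x - a *: z = y - b *: z -> x = y + (a - b) *: z.
Proof. by move=> E; rewrite scalerBl [a *: z - _]addrC addrA -E subrK. Qed.

Let recenter (t h : R) (w c : X) :
  w + c - h *: z = (w - t *: z) + (c + (t - h) *: z).
Proof. by rewrite scalerBl addrCA [w - _ + _]addrA subrK [w + c]addrC -addrA. Qed.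

Let sub_sub (x y u v : X) : (x - u) - (y - v) = (x - y) - (u - v).
Proof. by rewrite !opprB [v - y]addrC addrACA [- _ + _]addrC. Qed.

(** Only stretch [k] of the curve is described, so that finitely many vectors occur; the stretches
    are glued by [curve_agree]. *)
Definition curve (k : nat) (t : R) : X :=
  plateau (t - k%:R) *: e k + plateau (t - k%:R - 1) *: e k.+1.
Definition height (k : nat) (y : X) : R := k%:R + ramp (f k.+1 y).
(** The two shears, then a contraction by 10 to land in the unit ball. *)
Definition roll k (w : X) : X :=
  10^-1 *: (w + curve k (zs w) - height k (w + curve k (zs w)) *: z).
Definition unroll k (y : X) : X :=
  let u := 10 *: y + height k (10 *: y) *: z in u - curve k (zs u).

Lemma zs_curve k t : zs (curve k t) = 0.
Proof. exact: zs_comb. Qed.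

Lemma zs_add_curve k w t : zs (w + curve k t) = zs w.
Proof. by rewrite linearD /= zs_curve addr0. Qed.

Let f_shift i y c : f i (y + c *: z) = f i y.
Proof. by rewrite linearD linearZ fz /= scaler0 addr0. Qed.

Lemma height_shift k y c : height k (y + c *: z) = height k y.
Proof. by rewrite /height f_shift. Qed.

(** Neither shear alters the quantity that governs it: [zs] vanishes on the curve, and [f k.+1]
    vanishes at [z]. *)
Lemma rollK k : cancel (roll k) (unroll k).
Proof.
move=> w; rewrite /unroll /roll scalerA mulfV // scale1r.
set u := w + curve k (zs w); rewrite -scaleNr height_shift scaleNr subrK.
have -> : zs u = zs w by exact: zs_add_curve.
by rewrite /u addrK.
Qed.

Lemma unrollK k : cancel (unroll k) (roll k).
Proof.
move=> y; rewrite /unroll /roll.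
set u := 10 *: y + _.
have -> : zs (u - curve k (zs u)) = zs u by rewrite linearB /= zs_curve subr0.
by rewrite subrK {2}/u height_shift /u addrK scalerA mulVf // scale1r.
Qed.

Lemma f_curve_succ k t : f k.+1 (curve k t) = plateau (t - k%:R - 1).
Proof. exact: f_comb. Qed.

Lemma f_curve_later i k t : (k.+1 < i)%N -> f i (curve k t) = 0.
Proof. by move=> ki; apply: f_comb_later. Qed.

Let L := @step_lip R.

(** The constant is 2 plateaus, times slope [8 * L], times the bound 4 on the vectors. *)
Lemma curve_lipschitz k s t : `|curve k s - curve k t| <= 64 * L * `|s - t|.
Proof.
apply: le_trans (comb_dist _ _ _ _ _ _) _.
have h1 := plateau_lipschitz (s - k%:R) (t - k%:R).
have h2 := plateau_lipschitz (s - k%:R - 1) (t - k%:R - 1).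
rewrite [s - k%:R - (t - k%:R)](_ : _ = s - t) in h1; last by ring.
rewrite [s - k%:R - 1 - _](_ : _ = s - t) in h2; last by ring.
rewrite -mulrDl; apply: le_trans (ler_wpM2r (ler0n _ 4) (lerD h1 h2)) _.
by rewrite le_eqVlt; apply/orP; left; apply/eqP; rewrite -/L; move: L => l; ring.
Qed.

Lemma height_lipschitz k x y : `|height k x - height k y| <= 3 * L * `|x - y|.
Proof.
rewrite /height opprD addrACA subrr add0r; apply: le_trans (ramp_lipschitz _ _) _.
by rewrite -linearB ler_wpM2l // mulr_ge0 // step_lip_ge0.
Qed.

Let add_curve_lipschitz k x y :
  `|(x + curve k (zs x)) - (y + curve k (zs y))| <= (1 + 64 * L) * `|x - y|.
Proof.
rewrite opprD addrACA; apply: le_trans (ler_normD _ _) _.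
rewrite mulrDl mul1r lerD2l; apply: le_trans (curve_lipschitz _ _ _) _.
by rewrite -linearB ler_wpM2l // mulr_ge0 // step_lip_ge0.
Qed.

Let sub_curve_lipschitz k x y :
  `|(x - curve k (zs x)) - (y - curve k (zs y))| <= (1 + 64 * L) * `|x - y|.
Proof.
rewrite sub_sub; apply: le_trans (ler_normB _ _) _.
rewrite mulrDl mul1r lerD2l; apply: le_trans (curve_lipschitz _ _ _) _.
by rewrite -linearB ler_wpM2l // mulr_ge0 // step_lip_ge0.
Qed.

Let height_shear_lipschitz k x y :
  `|(x + height k x *: z) - (y + height k y *: z)| <= (1 + 3 * L) * `|x - y|.
Proof.
apply: le_trans (shear_dist _ _ _ _) _.
by rewrite mulrDl mul1r lerD2l height_lipschitz.
Qed.

Let sub_height_lipschitz k x y :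
  `|(x - height k x *: z) - (y - height k y *: z)| <= (1 + 3 * L) * `|x - y|.
Proof.
apply: le_trans (shear_sub_dist _ _ _ _) _.
by rewrite mulrDl mul1r lerD2l height_lipschitz.
Qed.

(** The Lipschitz constants of the two shears times the dilation in [unroll]; it depends on neither
    [X] nor [k]. *)
Definition lip_bound : R := 10 * ((1 + 3 * L) * (1 + 64 * L)).

Let L3 : 0 <= 1 + 3 * L. Proof. by rewrite addr_ge0 // mulr_ge0 // step_lip_ge0. Qed.
Let L64 : 0 <= 1 + 64 * L. Proof. by rewrite addr_ge0 // mulr_ge0 // step_lip_ge0. Qed.

Lemma roll_lipschitz k x y : `|roll k x - roll k y| <= lip_bound * `|x - y|.
Proof.
rewrite /roll -scalerBr normrZ ger0_norm //.
apply: le_trans (_ : _ <= 10^-1 * ((1 + 3 * L) * ((1 + 64 * L) * `|x - y|))) _.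
  rewrite ler_wpM2l //; apply: le_trans (sub_height_lipschitz _ _ _) _.
  by rewrite ler_wpM2l.
have : 0 <= (1 + 3 * L) * ((1 + 64 * L) * `|x - y|) by rewrite !mulr_ge0.
have -> : lip_bound * `|x - y| = 10 * ((1 + 3 * L) * ((1 + 64 * L) * `|x - y|)).
  by rewrite /lip_bound -!mulrA.
by move: (_ * _) => N; lra.
Qed.

Lemma unroll_lipschitz k x y : `|unroll k x - unroll k y| <= lip_bound * `|x - y|.
Proof.
rewrite /unroll; apply: le_trans (sub_curve_lipschitz _ _ _) _.
apply: le_trans (ler_wpM2l L64 (height_shear_lipschitz _ _ _)) _.
rewrite -scalerBr normrZ ger0_norm // /lip_bound le_eqVlt; apply/orP; left; apply/eqP; ring.
Qed.

Let Tz : @term R X := Tlin (Contraction zs_le).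
Let Tf k : @term R X := Tlin (Contraction (f_le k)).

(** The height is a term because [f k.+1] reads off the coefficient of [e k.+1] on the curve. *)
Lemma roll_vev k : exists s, roll k = vev 10^-1 s.
Proof.
pose p := Tplateau (Tadd Tz (Tcst (- k%:R))).
pose q := Tplateau (Tadd (Tadd Tz (Tcst (- k%:R))) (Tcst (- 1))).
pose h := Tadd (Tcst k%:R) (Tramp (Tadd (Tf k.+1) q)).
exists [:: (Tmul (Tcst 10^-1) p, e k); (Tmul (Tcst 10^-1) q, e k.+1);
           (Tmul (Tcst (- 10^-1)) h, z)].
apply/funext => w.
have hp : ev p w = plateau (zs w - k%:R) := ev_Tplateau _ _.
have hq : ev q w = plateau (zs w - k%:R - 1) := ev_Tplateau _ _.
have hh : ev h w = k%:R + ramp (f k.+1 w + ev q w).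
  by congr (_ + _); exact: ev_Tramp.
have hc : height k (w + curve k (zs w)) = ev h w.
  by rewrite /height [f _ _]linearD f_curve_succ -hq -hh.
rewrite /vev !big_cons big_nil addr0 /roll hc /curve -hp -hq.
exact: roll_expand.
Qed.

Lemma unroll_vev k : exists s, unroll k = vev 10 s.
Proof.
pose h := Tadd (Tcst k%:R) (Tramp (Tmul (Tcst 10) (Tf k.+1))).
pose u := Tadd (Tmul (Tcst 10) Tz) h.
pose p := Tplateau (Tadd u (Tcst (- k%:R))).
pose q := Tplateau (Tadd (Tadd u (Tcst (- k%:R))) (Tcst (- 1))).
exists [:: (h, z); (Tmul (Tcst (-1)) p, e k); (Tmul (Tcst (-1)) q, e k.+1)].
apply/funext => y.
have hh : ev h y = height k (10 *: y).
  by rewrite /height linearZ; congr (_ + _); exact: ev_Tramp.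
have hu : zs (10 *: y + ev h y *: z) = ev u y.
  by rewrite linearD !linearZ zsz /= [ev h y *: _]mulr1.
have hp : ev p y = plateau (ev u y - k%:R) := ev_Tplateau _ _.
have hq : ev q y = plateau (ev u y - k%:R - 1) := ev_Tplateau _ _.
rewrite /vev !big_cons big_nil addr0 /unroll -hh hu /curve -hp -hq.
exact: unroll_expand.
Qed.

(** An open cover of the tube in which only consecutive pieces meet, and only while the curve rests
    at [e k.+1]. *)
Definition piece (k : nat) : set X := [set w | [/\ 0 < zs w,
  `|w - zs w *: z| < 100^-1, k%:R - 4^-1 < zs w & zs w < k%:R + 5 / 4]].

Lemma plateau_next (a t : R) : a + 1 - 4^-1 < t -> t < a + 5 / 4 ->
  [/\ plateau (t - a) = 0, plateau (t - a - 1) = 1,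
      plateau (t - (a + 1)) = 1 & plateau (t - (a + 1) - 1) = 0].
Proof.
move=> t1 t2; split; [apply: plateau0r | apply: plateau1 | apply: plateau1 |
  apply: plateau0l]; lra.
Qed.

Lemma curve_agree j k t : k%:R - 4^-1 < t < k%:R + 5 / 4 ->
  j%:R - 4^-1 < t < j%:R + 5 / 4 -> curve j t = curve k t.
Proof.
wlog: j k / (j <= k)%N => [h tk tj|jk].
  by have [/h|/ltnW/h] := leqP j k; [exact | move=> ->].
move=> /andP[t1 t2] /andP[t3 t4].
move: jk; rewrite leq_eqVlt => /orP[/eqP->//|jk].
(* The lower end for [k] lies below the upper end for [j], so [k < j + 3 / 2]. *)
have kE : k = j.+1.
  apply/eqP; rewrite eqn_leq jk andbT -ltnS -(ltr_nat R) -!natr1; lra.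
move: t1 t2; rewrite kE -natr1 => t1 _.
have [p1 p2 p3 p4] := plateau_next t1 t4; rewrite natr1 in p3 p4.
by rewrite /curve p1 p2 p3 p4 !scale0r add0r addr0.
Qed.

Lemma piece_coord k w i : piece k w -> `|f i w| <= 100^-1.
Proof.
move=> [_ wz _ _]; have <- : f i (w - zs w *: z) = f i w by rewrite -scaleNr f_shift.
exact: le_trans (f_le _ _) (ltW wz).
Qed.

(* The height depends only on the point of the tube over the curve, because the
   functionals [f i] with [i] beyond the current segment nearly vanish there. *)
Lemma height_agree j k w v c : piece j w -> piece k v ->
  w + curve j (zs w) = v + curve k (zs v) + c *: z ->
  height j (w + curve j (zs w)) = height k (v + curve k (zs v)).
Proof.
wlog: j k w v c / (j <= k)%N => [h pj pk E|jk pj pk E].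
  have [jk|/ltnW kj] := leqP j k; first exact: (h j k w v c jk pj pk E).
  apply/esym/(h k j v w (- c) kj pk pj).
  by rewrite E scaleNr addrK.
set u := w + _ in E *; set u' := v + _ in E *.
have fE i : f i u = f i u' by rewrite E f_shift.
move: jk; rewrite leq_eqVlt => /orP[/eqP jk|jk].
  by rewrite jk /height fE.
pose p := plateau (zs v - k%:R); pose q := plateau (zs v - k%:R - 1).
have w_ i := piece_coord i pj; have v_ i := piece_coord i pk.
have fu' : f k.+1 u' = f k.+1 v + q by rewrite /u' linearD f_curve_succ.
have fu : f k.+1 u = f k.+1 w by rewrite /u linearD f_curve_later ?addr0.
have q0 := plateau_ge0 (zs v - k%:R - 1); rewrite -/q in q0.
have fuk : f k u' = f k v + (p + q * f k (e k.+1)).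
  by rewrite /u' linearD f_comb_head.
have f4 : `|f k (e k.+1)| <= 4 by apply: le_trans (f_le _ _) (e_le _).
(* Stretch [j] does not involve [e k.+1], so [f k.+1] is at most 1/100 at [u], and hence at [u']. *)
have q_le : q <= 2 / 100.
  have := fE k.+1; rewrite fu fu'.
  by have := w_ k.+1; have := v_ k.+1; rewrite !ler_norml; lra.
have qf : `|q * f k (e k.+1)| <= 8 / 100.
  rewrite normrM ger0_norm //.
  by apply: le_trans (ler_pM q0 (normr_ge0 _) q_le f4) _; lra.
(* Past time [k + 1/2] the coefficient [q] would already be 1. *)
have p1 : p = 1.
  have [_ _ t1 t2] := pk.
  rewrite /p plateau1 //; apply/andP; split; first lra.
  rewrite leNgt; apply/negP => h.
  by move: q_le; rewrite /q plateau1; lra.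
have fk9 : 91 / 100 <= f k u'.
  rewrite fuk p1; move: qf (v_ k); rewrite !ler_norml; lra.
(* A gap of two or more is impossible: [f k] would be at most 1/100 at [u]. *)
move: jk; rewrite leq_eqVlt => /orP[/eqP jk|jk]; last first.
  have fku : f k u = f k w by rewrite /u [f k _]linearD f_curve_later // addr0.
  have := le_trans fk9 (ler_norm _); rewrite -fE fku => h.
  by exfalso; move: (lt_le_trans (hundredth_lt R) (le_trans h (w_ k))); rewrite ltxx.
(* Remaining case [k = j.+1]: the ramp is complete on stretch [j] and has not begun on stretch [k],
   so both heights are [k]. *)
rewrite /height fu' jk fE ramp1 ?ramp0; first by rewrite -jk -natr1 addr0.
  by have := v_ k.+1; rewrite ler_norml; lra.
by lra.
Qed.

Lemma roll_agree j k w : piece j w -> piece k w -> roll j w = roll k w.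
Proof.
move=> pj pk; have [_ _ j1 j2] := pj; have [_ _ k1 k2] := pk.
have cE : curve j (zs w) = curve k (zs w) by apply: curve_agree; lra.
rewrite /roll; have -> : height j (w + curve j (zs w)) = height k (w + curve k (zs w)).
  by apply: (height_agree pj pk (c := 0)); rewrite cE scale0r addr0.
by rewrite cE.
Qed.

(** Equal images differ before the second shear by a multiple of [z] only, so [height_agree] undoes
    that shear. Then [zs] gives equal times, at which the two stretches coincide. *)
Lemma roll_inj j k w v : piece j w -> piece k v -> roll j w = roll k v -> w = v.
Proof.
move=> pj pk; rewrite /roll => /scale_tenth E.
have hE := height_agree pj pk (shear_eq E).
rewrite hE in E; have {}E := addIr _ E.
have tE : zs w = zs v.
  by rewrite -(zs_add_curve j w (zs w)) E zs_add_curve.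
have [_ _ j1 j2] := pj; have [_ _ k1 k2] := pk; rewrite tE in j1 j2 E.
have cE : curve j (zs v) = curve k (zs v).
  by apply: curve_agree; [rewrite k1 k2|rewrite j1 j2].
by rewrite cE in E; exact: addIr E.
Qed.

Lemma plateau_norm (s : R) : `|plateau s| <= 1.
Proof. by rewrite ger0_norm ?plateau_ge0 ?plateau_le1. Qed.

(** Before scaling, the cross-section contributes 1/100, the curve 8 and the offset between time and
    height 5/4, in all less than 10. *)
Lemma roll_norm_le1 k w : piece k w -> `|roll k w| <= 1.
Proof.
move=> [_ w1 t1 t2].
rewrite /roll normrZ gtr0_norm // ler_pdivrMl // mulr1.
set y := w + _; have [r0 r1] : 0 <= ramp (f k.+1 y) /\ ramp (f k.+1 y) <= 1.
  by split; [exact: ramp_ge0 | exact: ramp_le1].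
have -> : y - height k y *: z = (w - zs w *: z) + (curve k (zs w) + (zs w - height k y) *: z).
  exact: recenter.
apply: le_trans (ler_normD _ _) _.
have hc : `|curve k (zs w)| <= 8.
  apply: le_trans (comb_le _ _ _ _) _.
  have le8 (p q : R) : p <= 1 -> q <= 1 -> p * 4 + q * 4 <= 8.
    by move=> p1 q1; apply: le_trans (lerD (ler_wpM2r _ p1) (ler_wpM2r _ q1)) _ => //; lra.
  by apply: le8; exact: plateau_norm.
have hh : `|(zs w - height k y) *: z| <= 5 / 4.
  rewrite normrZ z1 mulr1 /height ler_norml.
  by move: (ramp _) r0 r1 => r r0 r1; move: t1 t2; move: (k%:R) => c t1 t2; lra.
have := ler_normD (curve k (zs w)) ((zs w - height k y) *: z).
move: hc hh w1; move: `|_| `|_| `|_| `|_| => p q r s; lra.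
Qed.

Let C := [set w | 0 < zs w /\ `|w - zs w *: z| < 100^-1].

Lemma piece_sub k : piece k `<=` C.
Proof. by move=> w [? ?]. Qed.

Lemma piece_trunc w : C w -> piece (Num.trunc (zs w)) w.
Proof.
move=> [t0 w1]; have /andP[t1 t2] := truncn_itv (ltW t0).
split=> //; first by lra.
by move: t2; rewrite -natr1; lra.
Qed.

Lemma piece_has_balls k : has_balls (piece k).
Proof.
move=> w [t0 w1 t1 t2].
(* The halving is there because [h - zs h *: z] can be twice as long as [h]. *)
pose m := Order.min (Order.min (zs w) ((100^-1 - `|w - zs w *: z|) / 2))
  (Order.min (zs w - (k%:R - 4^-1)) (k%:R + 5 / 4 - zs w)).
exists m; first by rewrite !lt_min t0 !subr_gt0 t1 t2 divr_gt0 // subr_gt0.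
move=> h; rewrite !lt_min -!andbA => /and4P[h1 h2 h3 h4].
have zh := zs_le h; have zD : zs (w + h) = zs w + zs h by rewrite linearD.
have zh' := zh; rewrite ler_norml in zh'.
split; rewrite zD; [by lra | | by lra | by lra].
have -> : w + h - (zs w + zs h) *: z = (w - zs w *: z) + (h - zs h *: z).
  by rewrite scalerDl opprD addrACA.
apply: le_lt_trans (ler_normD _ _) _.
have := ler_normB h (zs h *: z); rewrite [`|zs h *: z|]normrZ z1 mulr1.
by move: h2 zh; move: `|h - _| `|_| `|_| `|_| => a b c d; lra.
Qed.

Let image_piece k := [set y | piece k (unroll k y)].

Lemma image_piece_has_balls k : has_balls (image_piece k).
Proof.
move=> y py; have [d d0 hd] := piece_has_balls py.
have M0 : 0 < lip_bound by rewrite /lip_bound !mulr_gt0 // ltr_wpDr // mulr_ge0 // step_lip_ge0.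
exists (d / lip_bound) => [|h hh]; first exact: divr_gt0.
rewrite /image_piece /= -[unroll k (y + h)](subrK (unroll k y)) addrC; apply: hd.
apply: le_lt_trans (unroll_lipschitz _ _ _) _.
by rewrite addrAC subrr add0r mulrC -ltr_pdivlMr.
Qed.

(** The global map follows the piece selected by the integer part of [zs]. By [roll_agree] and
    injectivity, it and its inverse coincide with [roll k] and [unroll k] on open sets, and
    smoothness and derivative bounds are local. *)
Lemma tube_diffeo : exists pi : X -> X,
      (forall x y, C x -> C y -> pi x = pi y -> x = y) /\
      (forall x, C x -> `|pi x| <= 1) /\
      let T := pi @` C in
      open T /\
      (exists r : R, forall y, T y -> `|y| <= r) /\
      exists sigma : X -> X,
        (forall x, C x -> sigma (pi x) = x) /\
        (forall y, T y -> C (sigma y) /\ pi (sigma y) = y) /\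
        smooth_on C pi /\ smooth_on T sigma /\
        (forall x, C x -> differentiable pi x /\ (opnorm ('d pi x) <= lip_bound%:E)%E) /\
        (forall y, T y -> differentiable sigma y /\ (opnorm ('d sigma y) <= lip_bound%:E)%E).
Proof.
pose pi w := roll (Num.trunc (zs w)) w.
have piE k w : piece k w -> pi w = roll k w.
  by move=> pk; apply: roll_agree => //; apply/piece_trunc/(piece_sub pk).
have inj x y : C x -> C y -> pi x = pi y -> x = y.
  by move=> /piece_trunc px /piece_trunc py; exact: roll_inj.
have pi1 x : C x -> `|pi x| <= 1 by move=> /piece_trunc/roll_norm_le1.
have TP y : (pi @` C) y <-> exists k, image_piece k y.
  split=> [[x Cx <-]|[k ky]].
    by exists (Num.trunc (zs x)); rewrite /image_piece /= rollK; exact: piece_trunc.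
  by exists (unroll k y); [exact: piece_sub ky | rewrite (piE _ _ ky) unrollK].
have [sigma sigmaP] : {sigma : X -> X & forall y, (pi @` C) y -> C (sigma y) /\ pi (sigma y) = y}.
  apply: (@choice _ _ (fun y x => (pi @` C) y -> C x /\ pi x = y)) => y.
  (* Off the image the inverse takes the arbitrary value 0. *)
  by have [[x Cx <-]|nT] := pselect ((pi @` C) y); [exists x | exists 0].
have sigmaE k y : image_piece k y -> sigma y = unroll k y.
  move=> ky; have [|Cs ps] := sigmaP y; first by apply/TP; exists k.
  have Cy : C (unroll k y) := piece_sub ky.
  by apply: (inj _ _ Cs Cy); rewrite ps (piE _ _ ky) unrollK.
have M0 : 0 <= lip_bound by rewrite /lip_bound !mulr_ge0.
exists pi; split=> //; split=> //; split.
  apply/has_balls_open => y /TP[k ky]; have [d d0 hd] := image_piece_has_balls ky.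
  by exists d => // h hh; apply/TP; exists k; exact: hd.
split; first by exists 1 => _ [x Cx <-]; exact: pi1.
exists sigma; split=> [x Cx|].
  have [Cs ps] := sigmaP (pi x) (ex_intro2 _ _ x Cx erefl).
  exact: inj.
split=> //; split; [|split; [|split]].
- apply: smooth_on_local => x Cx; exists (piece (Num.trunc (zs x))); split.
  + exact: piece_has_balls.
  + exact: piece_trunc.
  + exact: piece_sub.
  + have [s sE] := roll_vev (Num.trunc (zs x)).
    apply: (@eq_smooth_on _ _ _ setT _ (vev 10^-1 s)) => // [w pw|].
      by rewrite (piE _ _ pw) sE.
    exact: smooth_on_vev.
- apply: smooth_on_local => y /TP[k ky]; exists (image_piece k); split=> //.
  + exact: image_piece_has_balls.
  + by move=> w kw; apply/TP; exists k.
  + have [s sE] := unroll_vev k.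
    apply: (@eq_smooth_on _ _ _ setT _ (vev 10 s)) => // [w pw|].
      by rewrite (sigmaE _ _ pw) sE.
    exact: smooth_on_vev.
- move=> x Cx; pose k := Num.trunc (zs x).
  have df : differentiable (roll k) x.
    by have [s ->] := roll_vev k; exact: differentiable_vev.
  exact: (differentiable_lipschitz (@piece_has_balls k) (piece_trunc Cx)
    (piE k) df (roll_lipschitz k) M0).
- move=> y /TP[k ky].
  have df : differentiable (unroll k) y.
    by have [s ->] := unroll_vev k; exact: differentiable_vev.
  exact: (differentiable_lipschitz (@image_piece_has_balls k) ky
    (sigmaE k) df (unroll_lipschitz k) M0).
Qed.

End Tube.

(** * The universal constants and the tube in terms of [zs] *)

Theorem theorem2p1 (R : realType) :
  exists M eps : R, 0 < M /\ 0 < eps /\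
  forall (X : completeNormedModType R) (z : X) (zs : {linear X -> R^o}),
    infinite_dimensional X ->
    continuous zs ->
    zs z = 1 -> opnorm zs = 1%E -> `|z| = 1 ->
    let C : set X := [set x | exists (h : X) (t : R),
                        zs h = 0 /\ `|h| < eps /\ 0 < t /\ x = h + t *: z] in
    exists pi : X -> X,
      (forall x y, C x -> C y -> pi x = pi y -> x = y) /\
      (forall x, C x -> `|pi x| <= 1) /\
      let T := pi @` C in
      open T /\
      (exists r : R, forall y, T y -> `|y| <= r) /\
      exists sigma : X -> X,
        (forall x, C x -> sigma (pi x) = x) /\
        (forall y, T y -> C (sigma y) /\ pi (sigma y) = y) /\
        smooth_on C pi /\ smooth_on T sigma /\
        (forall x, C x -> differentiable pi x /\ (opnorm ('d pi x) <= M%:E)%E) /\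
        (forall y, T y -> differentiable sigma y /\ (opnorm ('d sigma y) <= M%:E)%E).
Proof.
exists (@lip_bound R), 100^-1; split.
  rewrite /lip_bound !mulr_gt0 // ltr_wpDr // mulr_ge0 //; exact: step_lip_ge0.
split; first by rewrite invr_gt0.
move=> X z zs Xinf _ zsz zs1 z1 C.
have zs_le x : `|zs x| <= `|x|.
  have [->|x0] := eqVneq x 0; first by rewrite linear0 !normr0.
  have nx : 0 < `|x| by rewrite normr_gt0.
  have : (`|zs (`|x|^-1 *: x)|%:E <= 1%:E)%E.
    rewrite -zs1; apply: ereal_sup_ubound; exists (`|x|^-1 *: x) => //=.
    by rewrite normrZ normfV normr_id mulVf // gt_eqF.
  by rewrite lee_fin linearZ /= normrM normfV normr_id ler_pdivrMl // mulr1.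
(* The decomposition along the kernel and [z] is unique: [t] is [zs w] and [h] is
   [w - zs w *: z]. *)
have CE : C = [set w | 0 < zs w /\ `|w - zs w *: z| < 100^-1].
  apply/seteqP; split=> [w [h [t [zh [hlt [t0 ->]]]]]|w [t0 wlt]] /=.
    have -> : zs (h + t *: z) = t by rewrite linearD linearZ zh zsz add0r [LHS]mulr1.
    by rewrite addrK.
  exists (w - zs w *: z), (zs w); split; last by rewrite subrK.
  by rewrite linearB linearZ zsz [X in _ - X]mulr1 subrr.
have [e [f [ze f_le fe fe0]]] := biorthogonal_sequence Xinf zsz z1 zs_le.
rewrite CE; have ze0 k : zs (e k) = 0 by have [] := ze k.
have e4 k : `|e k| <= 4 by have [] := ze k.
have f1 k : f k (e k) = 1 by have [] := fe k.
have f0 k : f k z = 0 by have [] := fe k.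
exact: (tube_diffeo zsz z1 zs_le ze0 e4 f_le f1 f0 fe0).
Qed.
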